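(* $\frac{s}{2}-d_T(s)=\Theta(\sqrt{s})$ as $s\to\infty$. That is, there exist absolute constants $c,C>0$ and $s_0$ such that for every integer $s\ge s_0$, $$c\sqrt{s}\le \frac{s}{2}-d_T(s)\le C\sqrt{s}.$$
   Context: A tournament is a digraph obtained by orienting each edge of a finite complete graph in exactly one direction. The minimum out-degree $\delta^+(D)$ of a digraph $D$ is the minimum over its vertices of the number of out-neighbours. A subtournament of a tournament $T$ on $n$ vertices is the tournament $T[X]$ induced by a set $X$ of $n$ vertices. For a positive integer $s$, $d_T(s)$ denotes the largest integer $d$ such that, for every positive integer $n$, every tournament on $2n$ vertices with minimum out-degree at least $s$ contains a subtournament on $n$ vertices with minimum out-degree at least $d$. (The subscript $T$ in $d_T$ stands for ''tournament''; it is not a variable.) *)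

(* Defs.v *)
From mathcomp Require Import all_boot all_order all_algebra.
From mathcomp Require Import boolp reals.
From mathcomp Require Import zify.

Set Implicit Arguments.
Unset Strict Implicit.
Unset Printing Implicit Defensive.

(* A loopless digraph on V is given by its arc relation e. *)
Definition tournament (V : finType) (e : rel V) : Prop :=
  irreflexive e /\ forall x y : V, x != y -> e x y = ~~ e y x.

Definition outdeg (V : finType) (e : rel V) (x : V) : nat :=
  #|[set y | e x y]|.

(* The default value #|V| is an upper bound of all out-degrees, so it never
   affects the minimum when V is nonempty. *)
Definition min_outdeg (V : finType) (e : rel V) : nat :=
  \big[minn/#|V|]_(x : V) outdeg e x.

Definition induced (V : finType) (e : rel V) (X : {set V}) :
    rel {x : V | x \in X} :=
  fun x y => e (val x) (val y).

Definition halving_bound (s d : nat) : Prop :=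
  forall n : nat, 0 < n ->
  forall (V : finType) (e : rel V),
    #|V| = 2 * n -> tournament e -> s <= min_outdeg e ->
    exists X : {set V}, #|X| = n /\ d <= min_outdeg (induced e (X := X)).

Lemma leq_min_outdeg (V : finType) (e : rel V) (d : nat) :
  (d <= min_outdeg e) <-> (d <= #|V| /\ forall x, d <= outdeg e x).
Proof.
split=> [le_d|[dV dx]]; last first.
  rewrite /min_outdeg; elim/big_ind: _ => // m1 m2.
  by rewrite leq_min => -> ->.
have minP x : min_outdeg e <= outdeg e x.
  rewrite /min_outdeg; have := mem_index_enum x.
  elim: (index_enum V) => // y r IHr; rewrite inE big_cons geq_min.
  by case/orP=> [/eqP<-|/IHr->]; rewrite ?leqnn ?orbT.
split=> [|x]; last exact: leq_trans le_d (minP x).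
apply: leq_trans le_d _.
rewrite /min_outdeg; apply: (big_rec (fun m => m <= #|V|)) => // x m _ le_m.
by rewrite geq_min le_m orbT.
Qed.

Lemma halving_bound0 (s : nat) : halving_bound s 0.
Proof.
move=> n _ V e cardV _ _.
have : n <= #|[set: V]| by rewrite cardsT; lia.
case/card_geqP => r [Ur <- _].
by exists [set x in r]; rewrite cardsE (card_uniqP Ur).
Qed.

(* A near-regular tournament on 2s + 2 vertices with minimum out-degree at
   least s, used to bound the d such that halving_bound s d holds. *)
Definition parity_arc (N : nat) : rel 'I_N :=
  fun x y => if x < y then odd (x + y) else (y < x) && ~~ odd (x + y).

Lemma parity_tournament (N : nat) : tournament (@parity_arc N).
Proof.
split=> [x|x y]; first by rewrite /parity_arc ltnn.
rewrite -val_eqE neq_ltn /parity_arc [y + x]addnC => /orP[] h.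
  by rewrite h ltnNge (ltnW h) /= negbK.
by rewrite h ltnNge (ltnW h).
Qed.

Lemma parity_min_outdeg (s : nat) : s <= min_outdeg (@parity_arc (2 * s.+1)).
Proof.
apply/leq_min_outdeg; split=> [|x]; first by rewrite card_ord; lia.
pose v (k : nat) := if k < x./2 then k.*2 + odd x else k.*2.+1 + odd x.
have ltx := ltn_ord x.
have v_lt (k : 'I_s) : v k < 2 * s.+1.
  by have := ltn_ord k; rewrite /v; case: ifP; lia.
pose f (k : 'I_s) := Ordinal (v_lt k).
have f_inj : injective f.
  move=> i j /(congr1 val) /= eq_v; apply: val_inj; move: eq_v => /=.
  by rewrite /v; case: ifP; case: ifP; lia.
rewrite -[s in s <= _]card_ord -cardsT -(card_imset _ f_inj).
apply: subset_leq_card; apply/subsetP => _ /imsetP[k _ ->].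
rewrite inE /parity_arc /= /v; have := odd_double_half x.
by case: (ltnP k x./2) => hk hx; case: ifP => hlt; lia.
Qed.

Lemma halving_bound_le (s d : nat) : halving_bound s d -> d <= s.+1.
Proof.
move=> /(_ s.+1 isT 'I_(2 * s.+1) (@parity_arc _) (card_ord _)).
move=> /(_ (parity_tournament _) (parity_min_outdeg s)) [X [cardX]].
by case/leq_min_outdeg; rewrite card_sig cardX.
Qed.

Lemma halving_bound_ex (s : nat) : exists d, `[< halving_bound s d >].
Proof. by exists 0; apply/asboolP; exact: halving_bound0. Qed.

Lemma halving_bound_ub (s d : nat) : `[< halving_bound s d >] -> d <= s.+1.
Proof. by move/asboolP/halving_bound_le. Qed.

Definition dT (s : nat) : nat :=
  ex_maxn (halving_bound_ex s) (@halving_bound_ub s).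

Lemma dTP (s : nat) :
  halving_bound s (dT s) /\ forall d, halving_bound s d -> d <= dT s.
Proof.
rewrite /dT; case: ex_maxnP => d /asboolP hd max_d.
by split=> // d' hd'; apply: max_d; apply/asboolP.
Qed.

(* Main.v *)
Require Import Defs.
From mathcomp Require Import all_boot all_order all_algebra perm.
From mathcomp Require Import boolp reals.
From mathcomp.analysis Require Import sequences exp.
From mathcomp Require Import zify ring lra.
Import Order.TTheory GRing.Theory Num.Theory.
Local Open Scope ring_scope.

Set Implicit Arguments.
Unset Strict Implicit.
Unset Printing Implicit Defensive.

(** Write [n] for half the number of vertices; all constants are absolute.

    Why [dT s] is at least [s / 2 - O(sqrt s)].  Pair up the [2n] vertices and
    put exactly one vertex of each pair into [X]; this is a choice of [n] signs,
    and the out-degree of [v] into [X] differs from half its out-degree [k v] by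
    half of a signed sum of entries in [{-1, 0, 1}], at most [k v] of them
    nonzero.  Independent signs would lose a factor [sqrt (log s)]; as in
    Spencer's theorem, signs chosen in stages do not.  At each stage the
    pigeonhole principle ([pigeonhole_codes]) produces two colourings that agree
    on every rounded sum but differ in many places, and half of their difference
    settles a fixed proportion of the signs ([partial_coloring]).  The
    error allowed to [v] is proportional to [k v]: [weighted_discrepancy] bounds
    it by [O(k v / sqrt s)], which is harmless because [k - C k / sqrt s] is at
    least [s - C sqrt s] when [k >= s].  This works although [n] may be much
    larger than [s], because a tournament has at most [2t + 1] vertices of
    out-degree at most [t] ([card_low_outdeg]); hence the sum of [k v ^ (- 3/2)]
    over all vertices is [O(1 / sqrt s)] ([sum_outdeg_pow]), and this sum is
    exactly what the partial colourings have to pay for.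

    Why [dT s] is at most [s / 2 - c sqrt s].  Take [n = s + 1] and count
    tournaments on [2n] vertices.  The most popular score sequence is nearly
    regular, because moving one unit of score from a high vertex to a low one
    never decreases the number of realizations ([transfer_realizations],
    [popular_score]); so its realizations have minimum out-degree at least [s].
    Since the scores of most tournaments lie within [O(sqrt n)] of [n], it is
    realized by a fraction at least [(c / sqrt n) ^ (2n)] of all tournaments
    ([tours_le_popular]).  On the other hand, prescribing the scores of all
    vertices together with the scores inside a half [X] imposes [3n] conditions,
    which on geometric average cost a factor [O(1 / sqrt n)] each
    ([scores_in_half_count]).  If [X] has minimum out-degree [n / 2 - h] then its
    inner scores, having a fixed sum, form at most [(e (1 + h)) ^ n] sequences ([even_halves_count]).  If every
    realization of the popular sequence had such a half, summing over the at
    most [4 ^ n] sets [X] would give [n ^ (- n) <= (C (1 + h)) ^ n n ^ (- 3n/2)],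
    that is, [h >= c sqrt n]. *)

(** * Pigeonhole by cheap codes, and moments of random signs *)

Lemma geometric_le (R : realType) (q : R) (n : nat) :
  0 <= q -> q < 1 -> \sum_(i < n) q ^+ i <= (1 - q)^-1.
Proof.
move=> q0 q1; have q1' : 0 < 1 - q by rewrite subr_gt0.
rewrite -[leRHS]mul1r ler_pdivlMr // mulrC.
have := subrX1 q n; rewrite -[q - 1]opprB mulNr => e.
have -> : (1 - q) * \sum_(i < n) q ^+ i = 1 - q ^+ n by rewrite -[LHS]opprK -e opprB.
by rewrite gerBl exprn_ge0.
Qed.

Lemma expRN_lt1 (R : realType) (x : R) : 0 < x -> expR (- x) < 1.
Proof. by move=> x0; rewrite expR_lt1 oppr_lt0. Qed.

(** Charging [L k] for each unit of the [k]-th code entry gives [x] a total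
    charge [Z x], at most [B] on average, so the weights [expR (- Z x)] average at
    least [expR (- B)] because [expR] lies above its tangents.  Summed over all
    codes instead of over [A], these weights form a product of geometric series.
    This replaces the entropy argument usual for partial colourings, and it also
    counts the score sequences that stay near their mean. *)
Lemma pigeonhole_codes (R : realType) (C K : finType) (A : {set C})
    (c : C -> K -> nat) (L : K -> R) (B F : R) :
  (forall k, 0 < L k) -> 0 <= F ->
  \sum_(x in A) \sum_k L k * (c x k)%:R <= B * #|A|%:R ->
  (forall y, y \in A -> #|[set x in A | [forall k, c x k == c y k]]|%:R <= F) ->
  #|A|%:R <= expR B * \prod_k (1 - expR (- L k))^-1 * F.
Proof.
move=> L0 F0 avg fib.
pose M := (\max_(x in A) \max_k c x k)%N.
have cM x k : x \in A -> (c x k <= M)%N.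
  move=> xA; apply: (leq_trans (@leq_bigmax K (c x) k)).
  exact: (@leq_bigmax_cond _ (mem A) (fun x => \max_k c x k)%N).
pose code x : {ffun K -> 'I_M.+1} := [ffun k => inord (c x k)].
pose Z x := \sum_k L k * (c x k)%:R.
pose W (f : {ffun K -> 'I_M.+1}) := \prod_k expR (- L k) ^+ f k.
have WZ x : x \in A -> expR (- Z x) = W (code x).
  move=> xA; rewrite /Z -sumrN expR_sum; apply: eq_bigr => k _.
  by rewrite ffunE inordK ?ltnS ?cM // -expRM_natl mulrN mulrC.
have W0 f : 0 <= W f by apply: prodr_ge0 => k _; rewrite exprn_ge0 ?expR_ge0.
(* tangent line of the exponential at - B *)
have low : expR (- B) * #|A|%:R <= \sum_(x in A) expR (- Z x).
  apply: (@le_trans _ _ (\sum_(x in A) expR (- B) * (1 + (B - Z x)))).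
    rewrite -mulr_sumr ler_wpM2l ?expR_ge0 // big_split /= big_split /= sumrN.
    by rewrite !sumr_const -mulr_natr; move: avg; rewrite /Z; lra.
  apply: ler_sum => x _; rewrite [in leRHS](_ : - Z x = - B + (B - Z x)); last by ring.
  by rewrite expRD; apply: ler_wpM2l; [exact: expR_ge0 | exact: expR_ge1Dx].
have upp : \sum_(x in A) expR (- Z x) <= F * \prod_k (1 - expR (- L k))^-1.
  rewrite (eq_bigr (W \o code)) => [|x xA]; last exact: WZ.
  rewrite (partition_big code predT) //=.
  apply: (@le_trans _ _ (\sum_f F * W f)).
    apply: ler_sum => f _.
    have [y /andP[yA /eqP <-]|nof] := pickP (fun x => (x \in A) && (code x == f)).
      rewrite (eq_bigr (fun=> W (code y))) => [|x /andP[_ /eqP->] //].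
      rewrite sumr_const -[W _ *+ _]mulr_natl ler_wpM2r //.
      apply: le_trans (fib y yA); rewrite ler_nat.
      apply: subset_leq_card; apply/subsetP => x; rewrite !inE => /andP[xA /eqP e].
      rewrite xA; apply/forallP => k; move/ffunP: e => /(_ k).
      by rewrite !ffunE => /(congr1 val); rewrite /= !inordK ?ltnS ?cM // => ->.
    by rewrite big_pred0 // mulr_ge0.
  rewrite -mulr_sumr ler_wpM2l //.
  rewrite -(bigA_distr_bigA (fun k (j : 'I_M.+1) => expR (- L k) ^+ j)) /=.
  apply: ler_prod => k _; rewrite geometric_le ?expR_ge0 ?expRN_lt1 // andbT.
  by apply: sumr_ge0 => j _; rewrite exprn_ge0 ?expR_ge0.
have := le_trans low upp; rewrite expRN mulrC ler_pdivrMr ?expR_gt0 //.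
by move/le_trans; apply; rewrite le_eqVlt; apply/orP; left; apply/eqP; ring.
Qed.

Lemma big_involution (M : Type) (idx : M) (op : Monoid.com_law idx)
    (O : finType) (D : {set O}) (f : O -> O) (G : O -> M) :
  {in D, forall x, f x \in D} -> {in D, forall x, f (f x) = x} ->
  \big[op/idx]_(x in D) G (f x) = \big[op/idx]_(x in D) G x.
Proof.
move=> fD fK; apply/esym.
rewrite (reindex_onto f f) => [|x xD]; last exact: fK.
apply: eq_bigl => x; apply/andP/idP => [[fxD /eqP <-]|xD]; first exact: fD.
by rewrite fD // fK.
Qed.

(** A model of independent signs on the finite probability space [D], without
    a product structure on [D]: the involution attached to [j] negates [eps j] and
    preserves the other signs of [r], so every monomial of odd degree in [eps j]
    has mean zero.  Both colourings and tournaments are instances. *)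
Definition sign_family (R : realType) (O J : finType) (D : {set O})
    (eps : J -> O -> R) (r : seq J) :=
  {in r, forall j, {in D, forall x, eps j x ^+ 2 = 1} /\
   exists f : O -> O,
     [/\ {in D, forall x, f x \in D}, {in D, forall x, f (f x) = x},
         {in D, forall x, eps j (f x) = - eps j x} &
         {in r, forall i, i != j -> {in D, forall x, eps i (f x) = eps i x}}]}.

(** The fourth moment, not the second, is what makes the errors of successive
    colouring stages summable. *)
Lemma sign_family_moments (R : realType) (O J : finType) (D : {set O})
    (eps : J -> O -> R) (a : J -> R) (r : seq J) :
  sign_family D eps r -> uniq r ->
  \sum_(x in D) (\sum_(j <- r) a j * eps j x) ^+ 2
    = #|D|%:R * \sum_(j <- r) a j ^+ 2 /\
  \sum_(x in D) (\sum_(j <- r) a j * eps j x) ^+ 4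
    <= 3 * #|D|%:R * (\sum_(j <- r) a j ^+ 2) ^+ 2.
Proof.
elim: r => [|j r IHr] /=.
  move=> _ _; under eq_bigr do rewrite big_nil expr0n /=.
  under [X in _ /\ X <= _]eq_bigr do rewrite big_nil expr0n /=.
  by rewrite !big_nil !big1 // expr0n /= !mulr0.
move=> sgn /andP[jr r_uniq]; have [|//|m2 m4] := IHr.
  move=> i ir; have [|i2 [f [fD fK fi fo]]] := sgn i; first by rewrite inE ir orbT.
  by split=> //; exists f; split=> // k kr; apply: fo; rewrite inE kr orbT.
have [|eps2 [f [fD fK fj fi]]] := sgn j; first by rewrite inE eqxx.
pose S x := \sum_(i <- r) a i * eps i x.
have Sf x : x \in D -> S (f x) = S x.
  move=> xD; apply: eq_big_seq => i ir; rewrite fi ?inE ?ir ?orbT //.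
  by apply: contraNneq jr => <-.
(* the sum of the remaining terms does not see the flip of sign j *)
have odd0 (G : R -> R) : \sum_(x in D) eps j x * G (S x) = 0.
  apply/eqP; rewrite -[_ == 0](mulrn_eq0 _ 2) mulr2n -{1}(big_involution _ _ fD fK).
  by rewrite -big_split /= big1 // => x xD; rewrite fj // Sf // mulNr addNr.
set q := \sum_(i <- r) _ in m2 m4.
under eq_bigr do rewrite big_cons.
under [X in _ /\ X <= _]eq_bigr do rewrite big_cons.
rewrite big_cons -/q; split.
  rewrite (eq_bigr (fun x => (a j ^+ 2 + S x ^+ 2) + 2 * a j * (eps j x * S x))).
    rewrite big_split -mulr_sumr (odd0 id) mulr0. rewrite /= addr0 big_split /= m2.
    by rewrite sumr_const -[_ *+ _]mulr_natl -mulrDr.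
  move=> x xD; rewrite sqrrD exprMn eps2 // -/(S x); ring.
rewrite (eq_bigr (fun x => a j ^+ 4 + 6 * a j ^+ 2 * S x ^+ 2 + S x ^+ 4
     + (4 * a j ^+ 3 * (eps j x * S x) + 4 * a j * (eps j x * S x ^+ 3)))).
  rewrite big_split /= [X in _ + X]big_split /= -!mulr_sumr (odd0 id).
  rewrite (odd0 (fun s => s ^+ 3)) !mulr0 !addr0 !big_split /=.
  have -> : \sum_(x in D) 6 * a j ^+ 2 * S x ^+ 2 = 6 * a j ^+ 2 * (#|D|%:R * q).
    by rewrite -m2 mulr_sumr.
  rewrite sumr_const -[_ *+ _]mulr_natl.
  have q0 : 0 <= q by apply: sumr_ge0 => i _; rewrite sqr_ge0.
  have -> : 3 * #|D|%:R * (a j ^+ 2 + q) ^+ 2 = #|D|%:R * a j ^+ 4 +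
     6 * a j ^+ 2 * (#|D|%:R * q) + 3 * #|D|%:R * q ^+ 2 + 2 * (#|D|%:R * a j ^+ 4).
    ring.
  rewrite -[leLHS]addr0; apply: lerD; first by rewrite lerD2l; exact: m4.
  apply: mulr_ge0 => //; apply: mulr_ge0 => //; exact: exprn_even_ge0.
move=> x xD; rewrite -/(S x); have e2 := eps2 x xD.
have e3 : eps j x ^+ 3 = eps j x by rewrite exprS e2 mulr1.
have e4 : eps j x ^+ 4 = 1 by rewrite exprS e3 -expr2.
transitivity (a j ^+ 4 * eps j x ^+ 4 + 6 * a j ^+ 2 * S x ^+ 2 * eps j x ^+ 2
   + S x ^+ 4 + (4 * a j ^+ 3 * S x * eps j x ^+ 3 + 4 * a j * (eps j x * S x ^+ 3))).
  ring.
rewrite e2 e3 e4; ring.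
Qed.

(** * Partial colourings *)

(** The bound [expR L >= 1 + L ^ 3 / 27], valid for all [L = 1 / u], makes the
    price of a code cubic in [u] both for small and for large [u]. *)
Lemma code_factor_le (R : realType) (u : R) : 0 < u ->
  (1 - expR (- u^-1))^-1 <= expR (27 * u ^+ 3).
Proof.
move=> u0; set L := u^-1; have L0 : 0 < L by rewrite invr_gt0.
have l3 : 1 + L ^+ 3 / 27 <= expR L.
  have -> : expR L = expR (L / 3) ^+ 3 by rewrite -expRM_natl; congr expR; field.
  apply: (@le_trans _ _ ((1 + L / 3) ^+ 3)).
    have L2 : 0 <= L ^+ 2 by rewrite sqr_ge0.
    rewrite -subr_ge0 (_ : _ - _ = L + L ^+ 2 / 3); last by field.
    by rewrite addr_ge0 ?divr_ge0 // ltW.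
  by rewrite lerXn2r ?nnegrE ?expR_ge0 ?expR_ge1Dx // addr_ge0 // divr_ge0 // ltW.
have e1 : 0 < expR L - 1 by rewrite subr_gt0 expR_gt1.
have q0 : 0 < L ^+ 3 / 27 by rewrite divr_gt0 ?exprn_gt0.
have -> : (1 - expR (- L))^-1 = 1 + (expR L - 1)^-1.
  rewrite expRN; field; rewrite !gt_eqF ?expR_gt0 //=.
apply: le_trans (expR_ge1Dx _); rewrite lerD2l.
have -> : 27 * u ^+ 3 = (L ^+ 3 / 27)^-1 by rewrite /L; field; rewrite gt_eqF.
by rewrite lef_pV2 ?posrE //; lra.
Qed.

(** The code vanishes for [y < 1] and is at most [y] for [y >= 1], so its mean
    is controlled by a fourth moment. *)
Lemma truncn_code_le (R : realType) (y : R) :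
  (Num.truncn ((y + 1) / 2))%:R <= y ^+ 4.
Proof.
have [y1|y1] := ltP y 1.
  rewrite (_ : Num.truncn _ = 0%N) ?exprn_even_ge0 //.
  by apply/truncn0Pn; rewrite -ltNge; lra.
apply: (@le_trans _ _ ((y + 1) / 2)); first by rewrite truncn_le; lra.
apply: (@le_trans _ _ y); first by lra.
by rewrite -[leLHS]mulr1 exprS ler_wpM2l ?exprn_ege1 //; lra.
Qed.

(** The codes of [t] and of [- t] together locate [t] in an interval of length
    2, centred at 0 when both vanish. *)
Lemma truncn_code_inj (R : realType) (t t' : R) :
  Num.truncn ((t + 1) / 2) = Num.truncn ((t' + 1) / 2) ->
  Num.truncn ((- t + 1) / 2) = Num.truncn ((- t' + 1) / 2) ->
  `|t - t'| <= 2.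
Proof.
have ub (y : R) : y < 2 * (Num.truncn ((y + 1) / 2))%:R + 1.
  by move: (truncnS_gt ((y + 1) / 2)) => h; rewrite -[ltRHS]natr1 in h; lra.
have lb (y : R) : (0 < Num.truncn ((y + 1) / 2))%N ->
    2 * (Num.truncn ((y + 1) / 2))%:R - 1 <= y.
  rewrite truncn_gt0 => h.
  have : (Num.truncn ((y + 1) / 2))%:R <= (y + 1) / 2 by rewrite truncn_le; lra.
  by lra.
move=> e1 e2; rewrite ler_norml.
have := (ub t, ub t', ub (- t), ub (- t')); have := (lb t, lb t', lb (- t), lb (- t')).
rewrite -e1 -e2.
case: (Num.truncn ((t + 1) / 2)) => [|p] [[[l1 l2] l3] l4] [[[u1 u2] u3] u4];
  last by move: (l1 isT) (l2 isT); lra.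
move: l1 l2 l3 l4 u1 u2 u3 u4.
case: (Num.truncn ((- t + 1) / 2)) => [|p] _ _ l3 l4; first by lra.
by move: (l3 isT) (l4 isT); lra.
Qed.

(** Give a colouring the weight [8 ^ (- d)], where [d] is its distance to [y]
    on [S]; the total weight factors over the coordinates. *)
Lemma hamming_ball_le (R : realType) (J : finType) (S : {set J})
    (y : {ffun J -> bool}) (r : nat) :
  #|[set x : {ffun J -> bool} | (#|[set j in S | x j != y j]| <= r)%N]|%:R
   <= 2 ^+ #|J| * (9 / 16) ^+ #|S| * 8 ^+ r :> R.
Proof.
pose w (j : J) (b : bool) : R := if j \in S then if b != y j then 8^-1 else 1 else 1.
pose d (x : {ffun J -> bool}) := #|[set j in S | x j != y j]|.
have wd (x : {ffun J -> bool}) : \prod_j w j (x j) = 8^-1 ^+ d x.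
  rewrite -prodr_const [RHS]big_mkcond; apply: eq_bigr => j _.
  by rewrite /w inE; case: (j \in S).
have tot : \sum_(x : {ffun J -> bool}) \prod_j w j (x j)
    = 2 ^+ #|J| * (9 / 16) ^+ #|S|.
  rewrite -(bigA_distr_bigA w) /=.
  have -> : 2 ^+ #|J| = \prod_(j : J) 2 :> R by rewrite prodr_const.
  rewrite -prodr_const [X in _ = _ * X]big_mkcond -big_split /=; apply: eq_bigr => j _.
  rewrite big_bool /w; case: (j \in S); case: (y j) => /=; lra.
rewrite -ler_pdivrMr ?exprn_gt0 // -tot -sum1_card natr_sum mulr_suml.
rewrite big_mkcond; apply: ler_sum => x _; rewrite wd inE -/(d x).
case: leqP => h; last by rewrite exprn_ge0 ?invr_ge0.
by rewrite mul1r -exprVn; apply: ler_wiXn2l => //; rewrite ?invr_ge0 ?invf_le1 ?ler1n.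
Qed.

Lemma coloring_sign_family (R : realType) (J : finType) (r : seq J) :
  sign_family [set: {ffun J -> bool}] (fun j x => (-1) ^+ x j : R) r.
Proof.
move=> j _; split=> [x _|]; first by rewrite sqrr_sign.
exists (fun x : {ffun J -> bool} => [ffun i => x i (+) (i == j)]); split=> // [x _|x _|i _ ij x _].
- by apply/ffunP => i; rewrite !ffunE -addbA addbb addbF.
- by rewrite ffunE eqxx addbT signrN.
- by rewrite ffunE (negbTE ij) addbF.
Qed.

(** With the constants 180 and 16 of [partial_coloring], a Hamming ball is
    smaller than a largest code class, for every positive [m]. *)
Lemma partial_coloring_numeric (R : realType) (m r : nat) :
  (0 < m)%N -> (16 * r <= m)%N ->
  expR (m%:R / 3) * ((9 / 16) ^+ m * 8 ^+ r) < 1 :> R.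
Proof.
move=> m0 rm.
have e3 : expR (3^-1) <= 3 / 2 :> R.
  have h := expR_ge1Dx (- (3^-1) : R).
  have h0 := expR_gt0 (3^-1 : R).
  have : expR (3^-1 : R) * expR (- (3^-1)) = 1 by rewrite expRN divff ?gt_eqF.
  by nra.
rewrite expRM_natl mulrA -exprMn.
set q := expR _ * _.
have q0 : 0 <= q by rewrite mulr_ge0 ?expR_ge0 //; lra.
have q1 : q <= 27 / 32 by rewrite /q; lra.
apply: (@le_lt_trans _ _ ((27 / 32) ^+ m * 8 ^+ r)).
  by rewrite ler_wpM2r ?exprn_ge0 // lerXn2r // ?nnegrE; lra.
case: r rm => [|r] rm.
  by rewrite expr0 mulr1 exprn_ilt1 ?gt_eqF // ?lt0n_neq0 //; lra.
apply: (@le_lt_trans _ _ ((27 / 32) ^+ (16 * r.+1) * 8 ^+ r.+1)).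
  by rewrite ler_wpM2r ?exprn_ge0 //; apply: ler_wiXn2l rm; lra.
rewrite exprM -exprMn exprn_ilt1 //.
  by rewrite mulr_ge0 ?exprn_ge0 //; lra.
have h4 : (27 / 32) ^+ 4 <= 13 / 25 :> R by rewrite !exprS expr0; lra.
have h40 : 0 <= (27 / 32) ^+ 4 :> R by rewrite exprn_ge0 //; lra.
have : ((27 / 32) ^+ 4) ^+ 4 <= (13 / 25) ^+ 4 :> R by rewrite lerXn2r // ?nnegrE //; lra.
by rewrite -exprM [(13 / 25) ^+ 4]exprS !exprS expr0; lra.
Qed.

(** Here [u v] is the ratio between the standard deviation of the [v]-th signed
    sum and the error [D v] allowed to it, and [v] pays [u v ^ 3].  Rounding every
    sum to a multiple of [2 D v] leaves codes so cheap that some class is larger than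
    a Hamming ball; on the set [S1] where two far apart members [x], [y] of the
    class disagree, half the difference of their signs is the sign given by [x]. *)
Lemma partial_coloring (R : realType) (V J : finType) (A : V -> J -> R)
    (S : {set J}) (D u : V -> R) :
  S != set0 -> (forall v, 0 < D v) -> (forall v, 0 < u v) ->
  (forall v, \sum_(j in S) A v j ^+ 2 <= (u v * D v) ^+ 2) ->
  180 * \sum_v u v ^+ 3 <= #|S|%:R ->
  exists (chi : J -> bool) (S1 : {set J}),
    [/\ S1 \subset S, (#|S| < 16 * #|S1|)%N &
        forall v, `|\sum_(j in S1) (-1) ^+ chi j * A v j| <= D v].
Proof.
move=> S0 D0 u0 AuD usum.
pose t v (x : {ffun J -> bool}) := \sum_(j <- enum S) (A v j / D v) * (-1) ^+ x j.
pose c x (k : V * bool) := Num.truncn (((-1) ^+ k.2 * t k.1 x + 1) / 2).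
pose L (k : V * bool) := (u k.1)^-1.
pose m := #|S|; pose r := (m %/ 16)%N.
have m0 : (0 < m)%N by rewrite card_gt0.
pose F : R := 2 ^+ #|J| * (9 / 16) ^+ m * 8 ^+ r.
have F0 : 0 <= F by rewrite /F !mulr_ge0 ?exprn_ge0 ?divr_ge0.
pose U := \sum_v u v ^+ 3.
have t4 v : \sum_(x in [set: {ffun J -> bool}]) t v x ^+ 4
    <= 3 * (u v) ^+ 4 * #|[set: {ffun J -> bool}]|%:R.
  have [_ h] := sign_family_moments (fun j => A v j / D v)
                  (@coloring_sign_family R J (enum S)) (enum_uniq S).
  apply: le_trans h _; rewrite mulrAC ler_wpM2r // ler_wpM2l //.
  rewrite (_ : 4 = 2 * 2)%N // exprM lerXn2r ?nnegrE ?sqr_ge0 //.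
    by apply: sumr_ge0 => j _; rewrite sqr_ge0.
  rewrite big_enum /=; under eq_bigr do rewrite expr_div_n.
  by rewrite -mulr_suml ler_pdivrMr ?exprn_gt0 // -exprMn.
have avg : \sum_(x in [set: {ffun J -> bool}]) \sum_k L k * (c x k)%:R
    <= (6 * U) * #|[set: {ffun J -> bool}]|%:R.
  apply: (@le_trans _ _ (\sum_(x in [set: {ffun J -> bool}])
      \sum_v 2 * (u v)^-1 * t v x ^+ 4)).
    apply: ler_sum => x _.
    rewrite -(pair_bigA _ (fun v b => L (v, b) * (c x (v, b))%:R)) /=.
    apply: ler_sum => v _; rewrite big_bool /L /c /= -mulrDr (mulrC 2) -mulrA.
    rewrite ler_wpM2l ?invr_ge0 ?(ltW (u0 v)) // expr0 expr1 mulN1r mul1r.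
    rewrite (_ : 2 * t v x ^+ 4 = (- t v x) ^+ 4 + t v x ^+ 4); last by ring.
    by rewrite lerD ?truncn_code_le.
  rewrite exchange_big /= /U mulr_sumr mulr_suml; apply: ler_sum => v _.
  rewrite -mulr_sumr; apply: le_trans (ler_wpM2l _ (t4 v)) _.
    by rewrite mulr_ge0 ?invr_ge0 ?(ltW (u0 v)).
  by rewrite le_eqVlt; apply/orP; left; apply/eqP; field; rewrite gt_eqF.
(* either two colourings of one class are far apart, or classes are small *)
have [[[x y] /= far same]|allclose] :=
    pselect (exists2 p : {ffun J -> bool} * {ffun J -> bool},
      (m < 16 * #|[set j in S | p.1 j != p.2 j]|)%N & forall k, c p.1 k = c p.2 k).
  exists x, [set j in S | x j != y j]; split=> //.
    by apply/subsetP => j; rewrite inE => /andP[].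
  move=> v; have := truncn_code_inj (t := t v x) (t' := t v y).
  have /= := same (v, false); rewrite /c /= expr0 !mul1r => e1 /(_ e1).
  have /= := same (v, true); rewrite /c /= expr1 !mulN1r => e2 /(_ e2).
  have -> : t v x - t v y
      = 2 / D v * \sum_(j in [set j in S | x j != y j]) (-1) ^+ x j * A v j.
    rewrite /t !big_enum -sumrB mulr_sumr /=.
    rewrite [RHS](eq_bigl (fun j => (j \in S) && (x j != y j))); last first.
      by move=> j; rewrite inE.
    rewrite big_mkcondr; apply: eq_bigr => j _.
    by case: (x j) (y j) => [] [] /=; rewrite ?expr0 ?expr1; field; rewrite gt_eqF.
  rewrite normrM [`|2 / _|]gtr0_norm ?divr_gt0 // -ler_pdivlMl ?divr_gt0 //.
  by rewrite (_ : (2 / D v)^-1 * 2 = D v) //; field; rewrite gt_eqF.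
have fib y : y \in [set: {ffun J -> bool}] ->
    #|[set x in [set: {ffun J -> bool}] | [forall k, c x k == c y k]]|%:R <= F.
  move=> _; apply: le_trans (hamming_ball_le R S y r); rewrite ler_nat.
  apply: subset_leq_card; apply/subsetP => x; rewrite !inE /= => /forallP e.
  rewrite leqNgt; apply/negP => h; apply: allclose; exists (x, y) => /=.
    by move: h; rewrite /r; lia.
  by move=> k; apply/eqP.
have := pigeonhole_codes (L := L) (fun k => etrans (invr_gt0 _) (u0 k.1)) F0 avg fib.
rewrite cardsT card_ffun card_bool natrX => key; exfalso; move: key; apply/negP.
rewrite -ltNge.
have prodL : \prod_k (1 - expR (- L k))^-1 <= expR (54 * U).
  apply: (@le_trans _ _ (\prod_(k : V * bool) expR (27 * u k.1 ^+ 3))).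
    apply: ler_prod => k _; rewrite code_factor_le // andbT invr_ge0 subr_ge0 ltW //.
    by rewrite expRN_lt1 // invr_gt0.
  rewrite -expR_sum -(pair_bigA _ (fun v (b : bool) => 27 * u v ^+ 3)) /=.
  rewrite /U mulr_sumr ler_expR; apply: ler_sum => v _.
  by rewrite big_bool /=; lra.
apply: (@le_lt_trans _ _ (expR (m%:R / 3) * F)).
  apply: ler_wpM2r => //.
  apply: (@le_trans _ _ (expR (6 * U) * expR (54 * U))).
    by apply: ler_wpM2l => //; rewrite expR_ge0.
  by rewrite -expRD ler_expR; move: usum; rewrite -/U -/m; lra.
have := @partial_coloring_numeric R m r m0; rewrite (_ : 16 * r <= m)%N; last first.
  by rewrite /r; lia.
move=> /(_ isT) h; rewrite /F -!mulrA mulrCA -[ltRHS]mulr1.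
by rewrite ltr_pM2l // exprn_gt0.
Qed.

(** * Colourings of small weighted discrepancy *)

Lemma sixth_root (R : realType) (a : R) : 0 <= a -> {x : R | 0 <= x & x ^+ 6 = a}.
Proof.
move=> a0; exists (powR a 6^-1); first exact: powR_ge0.
rewrite -powR_mulrn ?powR_ge0 // -powRrM mulVf ?pnatr_eq0 // powRr1 //.
Qed.

(** Used with [x ^ 6] live signs, [sg ^ 6 = s] and [ka ^ 2 = k v]: the squared
    norm [a] of the live entries of [v] is at most both [ka ^ 2] and [x ^ 6], and
    the two cases [x <= sg] and [sg <= x] need one bound each. *)
Lemma stage_budget (R : realType) (a x sg ka : R) :
  0 < x -> 0 < sg -> sg ^+ 3 <= ka -> a <= ka ^+ 2 -> a <= x ^+ 6 ->
  a <= (4 * x ^+ 3 * ka / (sg * (x + sg) ^+ 2)) ^+ 2.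
Proof.
move=> x0 sg0 sgka aka ax.
have ka0 : 0 < ka by apply: lt_le_trans sgka; rewrite exprn_gt0.
have xs0 : 0 < x + sg by rewrite addr_gt0.
have x30 : 0 <= x ^+ 3 by rewrite exprn_ge0 // ltW.
have q0 : 0 <= 4 * x ^+ 3 * ka / (sg * (x + sg) ^+ 2).
  by rewrite divr_ge0 ?mulr_ge0 ?exprn_ge0 // ltW.
have [xsg|sgx] := leP x sg.
  apply: le_trans ax _; rewrite -[6%N]/(3 * 2)%N exprM.
  rewrite lerXn2r ?nnegrE //.
  rewrite ler_pdivlMr ?mulr_gt0 ?exprn_gt0 //.
  rewrite -[leRHS]mulrA [leRHS]mulrCA ler_pM2l ?exprn_gt0 //.
  apply: (@le_trans _ _ (sg * (2 * sg) ^+ 2)); last first.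
    by rewrite (_ : _ * _ = 4 * sg ^+ 3); [rewrite ler_pM2l | ring].
  rewrite ler_pM2l //; rewrite lerXn2r ?nnegrE; lra.
apply: le_trans aka _.
rewrite lerXn2r ?nnegrE ?(ltW ka0) //.
rewrite ler_pdivlMr ?mulr_gt0 ?exprn_gt0 // [leRHS]mulrC ler_pM2l //.
apply: (@le_trans _ _ (x * (2 * x) ^+ 2)); last first.
  by rewrite (_ : _ * _ = 4 * x ^+ 3) //; ring.
rewrite ler_pM ?exprn_ge0 ?(ltW sg0) ?(ltW sgx) ?(ltW xs0) //.
by rewrite lerXn2r ?nnegrE; lra.
Qed.

(** The error allowed at a stage peaks at [x = sg] and decays geometrically on
    both sides, so the stages add up to a bounded multiple of the peak; the
    function [x / (x + sg)] realizes the sum as a telescoping one. *)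
Lemma stage_telescope (R : realType) (k x sg : R) :
  0 < k -> 0 < x -> 0 < sg ->
  100 * k * x / (sg ^+ 2 * (x + sg) ^+ 2)
   + 100 ^+ 2 * k * (99 / 100 * x) / (sg ^+ 3 * (99 / 100 * x + sg))
   <= 100 ^+ 2 * k * x / (sg ^+ 3 * (x + sg)).
Proof.
move=> k0 x0 sg0.
have y0 : 0 < 99 / 100 * x + sg by lra.
have xs0 : 0 < x + sg by lra.
rewrite -subr_ge0 (_ : _ - _ = x ^+ 2 * k / (sg ^+ 2 * (x + sg) ^+ 2 * (99 / 100 * x + sg))).
  by rewrite divr_ge0 ?mulr_ge0 ?exprn_ge0 ?ltW.
have z0 : 99 * x + sg * 100 != 0 by rewrite gt_eqF //; lra.
by field; rewrite z0 !gt_eqF.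
Qed.

(** The live set shrinks by a factor 15/16 per stage, hence its sixth root [z]
    by a factor at most 99/100.  The choices of [D] and [u] make [u v ^ 3]
    proportional to [z ^ 6], the number of live signs, times
    [sqrt s / (k v * sqrt (k v))], whose sum over [v] is bounded by hypothesis. *)
Lemma weighted_discrepancy (R : realType) (V J : finType) (A : V -> J -> R)
    (k : V -> R) (s : R) :
  0 < s -> (forall v, s <= k v) -> (forall v j, A v j ^+ 2 <= 1) ->
  (forall v, \sum_j A v j ^+ 2 <= k v) ->
  \sum_v (k v * Num.sqrt (k v))^-1 <= 16 / Num.sqrt s ->
  exists chi : J -> bool,
    forall v, `|\sum_j (-1) ^+ chi j * A v j| <= 100 ^+ 2 * k v / Num.sqrt s.
Proof.
move=> s0 sk A1 Ak ksum.
have [sg sg0 sg6] := sixth_root (ltW s0).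
have {}sg0 : 0 < sg.
  by rewrite lt_def sg0 andbT; apply: contraTneq s0 => e; rewrite -sg6 e expr0n ltxx.
have sqs : Num.sqrt s = sg ^+ 3 by rewrite -sg6 (exprM _ 3 2) sqrtr_sqr gtr0_norm ?exprn_gt0.
have k0 v : 0 < k v by apply: lt_le_trans (sk v).
pose f v (x : R) := 100 ^+ 2 * k v * x / (sg ^+ 3 * (x + sg)).
suff main : forall n (S : {set J}) (x : R), (#|S| <= n)%N -> 0 <= x -> #|S|%:R <= x ^+ 6 ->
    exists chi : J -> bool, forall v, `|\sum_(j in S) (-1) ^+ chi j * A v j| <= f v x.
  have [x x0 x6] := sixth_root (ler0n R #|[set: J]|).
  have [//|chi bchi] := main _ [set: J] x (leqnn _) x0; first by rewrite x6.
  exists chi => v; have := bchi v; rewrite (eq_bigl predT) => [h|j]; last by rewrite inE.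
  apply: le_trans h _; rewrite /f sqs invfM mulrA ler_pdivrMr; last by rewrite ltr_wpDl.
  rewrite mulrAC ler_pM2l ?lerDl ?ltW // ?divr_gt0 ?mulr_gt0 ?exprn_gt0 //.
have f_homo v (x y : R) : 0 <= x -> x <= y -> f v x <= f v y.
  move=> x0 xy; rewrite /f ler_pdivrMr ?mulr_gt0 ?exprn_gt0 ?ltr_wpDl //.
  rewrite [leRHS]mulrAC ler_pdivlMr ?mulr_gt0 ?exprn_gt0 ?ltr_wpDl ?(le_trans x0) //.
  have c0 : 0 <= 100 ^+ 2 * k v * sg ^+ 3 * sg by rewrite !mulr_ge0 ?exprn_ge0 ?ltW.
  rewrite -subr_ge0 (_ : _ - _ = 100 ^+ 2 * k v * sg ^+ 3 * sg * (y - x)); last by ring.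
  by rewrite mulr_ge0 ?subr_ge0.
have f_ge0 v x : 0 <= x -> 0 <= f v x.
  move=> x0; apply: divr_ge0; last first.
    by apply: mulr_ge0; [apply: exprn_ge0; apply: ltW | apply: addr_ge0 => //; apply: ltW].
  by apply: mulr_ge0 => //; apply: mulr_ge0; [rewrite exprn_ge0 | apply: ltW].
elim=> [|n IHn] S x.
  rewrite leqn0 cards_eq0 => /eqP-> x0 _; exists xpredT => v.
  by rewrite big_set0 normr0 f_ge0.
have [->|S0] := eqVneq S set0.
  move=> _ x0 _; exists xpredT => v.
  by rewrite big_set0 normr0 f_ge0.
move=> Sn x0 Sx; have [z z0 z6] := sixth_root (ler0n R #|S|).
have {}z0 : 0 < z.
  rewrite lt_def z0 andbT; apply: contra_neq S0 => e.
  by apply/eqP; rewrite -cards_eq0 -(eqr_nat R) -z6 e expr0n.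
have zx : z <= x by rewrite -(@ler_pXn2r _ 6) ?nnegrE ?z6 // ltW.
pose D v := 100 * k v * z / (sg ^+ 2 * (z + sg) ^+ 2).
pose u v := z ^+ 2 * sg / (25 * Num.sqrt (k v)).
have ka0 v : 0 < Num.sqrt (k v) by rewrite sqrtr_gt0.
have ka2 v : Num.sqrt (k v) ^+ 2 = k v by rewrite sqr_sqrtr // ltW.
have zs0 : 0 < z + sg by rewrite addr_gt0.
have [v|v|v||chi1 [S1 [S1S big1 disc1]]] := @partial_coloring R V J A S D u S0.
- by rewrite /D divr_gt0 ?mulr_gt0 ?exprn_gt0.
- by rewrite /u divr_gt0 ?mulr_gt0 ?exprn_gt0.
- have -> : u v * D v = 4 * z ^+ 3 * Num.sqrt (k v) / (sg * (z + sg) ^+ 2).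
    rewrite /u /D; move: (ka0 v) (ka2 v); move: (Num.sqrt (k v)) => ka ka0v <-.
    by field; rewrite !gt_eqF.
  apply: stage_budget => //.
  + by rewrite -sqs; apply: ler_wsqrtr; exact: sk.
  + rewrite ka2; apply: le_trans (Ak v); rewrite [leRHS](bigID (mem S)) /= lerDl.
    by apply: sumr_ge0 => j _; rewrite sqr_ge0.
  + by rewrite z6 -sum1_card natr_sum; apply: ler_sum.
- rewrite -z6 (eq_bigr (fun v => z ^+ 6 * sg ^+ 3 / 25 ^+ 3 * (k v * Num.sqrt (k v))^-1)).
    rewrite -mulr_sumr.
    have c0 : 0 <= z ^+ 6 * sg ^+ 3 / 25 ^+ 3 by rewrite divr_ge0 ?mulr_ge0 ?exprn_ge0 ?ltW.
    have := ler_wpM2l c0 ksum; rewrite sqs.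
    have -> : z ^+ 6 * sg ^+ 3 / 25 ^+ 3 * (16 / sg ^+ 3) = 16 / 25 ^+ 3 * z ^+ 6.
      by field; rewrite gt_eqF.
    have : 0 <= z ^+ 6 by rewrite exprn_ge0 // ltW.
    by lra.
  move=> v _; rewrite /u; move: (ka0 v) (ka2 v).
  by move: (Num.sqrt (k v)) => ka ka0v <-; field; rewrite gt_eqF.
have cardD : (#|S :\: S1| = #|S| - #|S1|)%N.
  by rewrite cardsD (setIidPr S1S).
have leS1 := subset_leq_card S1S.
have [|||chi2 disc2] := IHn (S :\: S1) (99 / 100 * z).
- by rewrite cardD; lia.
- by rewrite mulr_ge0 ?divr_ge0 // ltW.
- rewrite exprMn z6 cardD.
  apply: (@le_trans _ _ (15 / 16 * #|S|%:R)).
    have : (16 * (#|S| - #|S1|))%N%:R <= (15 * #|S|)%N%:R :> R by rewrite ler_nat; lia.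
    by rewrite !natrM; lra.
  by rewrite ler_wpM2r // !exprS expr0; lra.
exists (fun j => if j \in S1 then chi1 j else chi2 j) => v.
apply: le_trans (f_homo v z x _ zx); last exact: ltW.
apply: le_trans (stage_telescope (k0 v) z0 sg0).
rewrite (big_setID S1) /= (setIidPr S1S); apply: le_trans (ler_normD _ _) _.
apply: lerD.
  by rewrite (eq_bigr (fun j => (-1) ^+ chi1 j * A v j)) ?disc1 // => j ->.
rewrite (eq_bigr (fun j => (-1) ^+ chi2 j * A v j)) ?disc2 // => j.
by rewrite inE => /andP[/negbTE -> _].
Qed.

(** * Halving a tournament *)

(** Each pair of vertices of [S] is counted from exactly one of its ends. *)
Lemma sum_scores (V : finType) (e : rel V) (S : {set V}) : tournament e ->
  (2 * \sum_(x in S) #|[set y in S | e x y]| = #|S| * #|S|.-1)%N.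
Proof.
case=> irr tot.
have sc : (\sum_(x in S) #|[set y in S | e x y]|
    = \sum_(x in S) \sum_(y in S) e x y)%N.
  apply: eq_bigr => x _; rewrite -sum1_card big_mkcond [RHS]big_mkcond /=.
  by apply: eq_bigr => y _; rewrite !inE; case: (y \in S); case: (e x y).
rewrite mul2n -addnn {1}sc exchange_big sc -big_split /=.
rewrite -sum_nat_const; apply: eq_bigr => x xS.
rewrite -big_split /= (bigD1 x) //= irr add0n (cardsD1 x) xS /= -sum1_card.
rewrite [LHS](eq_bigr (fun=> 1%N)); last first.
  by move=> y /andP[_ yx]; rewrite (tot y x yx); case: (e x y).
by apply: eq_bigl => y; rewrite !inE andbC.
Qed.

(** In the subtournament on these vertices the average out-degree is half the
    number of vertices minus one half. *)
Lemma card_low_outdeg (V : finType) (e : rel V) (k : nat) : tournament e ->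
  (#|[set v | outdeg e v <= k]| <= k.*2.+1)%N.
Proof.
move=> tour; set S := [set v | _].
have : (\sum_(x in S) #|[set y in S | e x y]| <= #|S| * k)%N.
  rewrite -sum_nat_const; apply: leq_sum => x; rewrite inE; apply: leq_trans.
  by apply: subset_leq_card; apply/subsetP => y; rewrite !inE => /andP[].
move=> h; have : (#|S| * #|S|.-1 <= #|S| * k.*2)%N.
  by rewrite -(sum_scores S tour) -mul2n mulnCA leq_mul2l h orbT.
by case: #|S| => // m; rewrite leq_mul2l.
Qed.

(** Remove a vertex [a] of largest [k] from a set of [m + 1] vertices: then
    [m <= 2 k a], so [2 s + m <= 4 k a] and the term of [a] is bounded by an
    increment of a function of [m] alone, which telescopes. *)
Lemma sum_outdeg_pow (R : realType) (V : finType) (k : V -> nat) (s : nat) :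
  (0 < s)%N -> (forall v, s <= k v)%N ->
  (forall t, #|[set v | k v <= t]| <= t.*2.+1)%N ->
  \sum_v ((k v)%:R * Num.sqrt (k v)%:R)^-1 <= 16 / Num.sqrt s%:R :> R.
Proof.
move=> s0 sk low.
pose q (m : nat) : R := (Num.sqrt m%:R)^-1.
have q0 m : 0 <= q m by rewrite invr_ge0 sqrtr_ge0.
have step (a : V) (m : nat) : (m <= (k a).*2)%N ->
    ((k a)%:R * Num.sqrt (k a)%:R)^-1 <= 16 * (q (2 * s + m).-1 - q (2 * s + m)%N).
  move=> mk; have ska := sk a; pose T := (2 * s + m)%N.
  rewrite -/T /q; have T2 : (2 <= T)%N by rewrite /T; lia.
  have T4k : (T <= 4 * k a)%N by rewrite /T; lia.
  set x := Num.sqrt T.-1%:R; set y := Num.sqrt T%:R; set z := Num.sqrt (k a)%:R.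
  have x0 : 0 < x by rewrite sqrtr_gt0 ltr0n; lia.
  have y0 : 0 < y by rewrite sqrtr_gt0 ltr0n; lia.
  have z0 : 0 < z by rewrite sqrtr_gt0 ltr0n; lia.
  have x2 : x ^+ 2 = T.-1%:R by rewrite sqr_sqrtr.
  have y2 : y ^+ 2 = T%:R by rewrite sqr_sqrtr.
  have z2 : z ^+ 2 = (k a)%:R by rewrite sqr_sqrtr.
  have xy2 : y ^+ 2 = x ^+ 2 + 1 by rewrite x2 y2 natr1 prednK //; lia.
  (* from 2 s + m <= 4 k a *)
  have yz : y <= 2 * z.
    rewrite -(@ler_pXn2r _ 2) ?nnegrE ?mulr_ge0 ?(ltW z0) ?(ltW y0) //.
    by rewrite exprMn y2 z2 -natrX -natrM ler_nat.
  have xy : x <= y.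
    by rewrite -(@ler_pXn2r _ 2) ?nnegrE ?(ltW x0) ?(ltW y0) // xy2 lerDl.
  have -> : x^-1 - y^-1 = (x * y * (x + y))^-1.
    transitivity ((y ^+ 2 - x ^+ 2) * (x * y * (x + y))^-1); last first.
      by rewrite xy2 addrAC subrr add0r mul1r.
    by field; rewrite !gt_eqF // addr_gt0.
  rewrite -z2 -exprSr.
  apply: (@le_trans _ _ (8 / y ^+ 3)).
    rewrite ler_pdivlMr ?exprn_gt0 // mulrC ler_pdivrMr ?exprn_gt0 //.
    have -> : 8 * z ^+ 3 = (2 * z) ^+ 3 by ring.
    by rewrite lerXn2r ?nnegrE ?mulr_ge0 ?(ltW z0) ?(ltW y0).
  have -> : 16 * (x * y * (x + y))^-1 = 8 / (x * y * ((x + y) / 2)).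
    by field; rewrite !gt_eqF // addr_gt0.
  rewrite ler_pM2l // lef_pV2 ?posrE ?exprn_gt0 ?mulr_gt0 ?addr_gt0 ?invr_gt0 //.
  rewrite !exprS expr0 mulr1 mulrA ler_pM ?mulr_ge0 ?addr_ge0 ?invr_ge0 ?(ltW x0) ?(ltW y0) //.
    by rewrite ler_pM2r.
  by lra.
suff main n (S : {set V}) : #|S| = n ->
    \sum_(v in S) ((k v)%:R * Num.sqrt (k v)%:R)^-1
      <= 16 * (q (2 * s).-1 - q (2 * s + n).-1).
  have := main _ [set: V] erefl; rewrite (eq_bigl predT) => [h|v]; last by rewrite inE.
  apply: le_trans h _; rewrite ler_pM2l //.
  apply: (@le_trans _ _ (q (2 * s).-1)); first by rewrite gerBl.
  rewrite /q lef_pV2 ?posrE ?sqrtr_gt0 ?ltr0n //; last by lia.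
  by apply: ler_wsqrtr; rewrite ler_nat; lia.
elim: n S => [|n IHn] S Sn.
  by rewrite (cards0_eq Sn) big_set0 addn0 subrr mulr0.
have /card_gt0P[a0 a0S] : (0 < #|S|)%N by rewrite Sn.
pose a := [arg max_(a > a0 in S) k a]%N.
have [aS amax] : a \in S /\ forall b, b \in S -> (k b <= k a)%N.
  by rewrite /a; case: arg_maxnP.
have Sa : #|S :\ a| = n by move: Sn; rewrite (cardsD1 a) aS => -[].
rewrite (big_setD1 a) //= addrC.
have na : (n <= (k a).*2)%N.
  rewrite -ltnS -Sn; apply: leq_trans (low (k a)).
  by apply: subset_leq_card; apply/subsetP => b bS; rewrite inE amax.
apply: le_trans (lerD (IHn _ Sa) (step a n na)) _.
by rewrite addnS /=; lra.
Qed.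

Lemma outdeg_induced (V : finType) (e : rel V) (X : {set V}) (x : {x | x \in X}) :
  outdeg (induced e (X := X)) x = #|[set y in X | e (val x) y]|.
Proof.
rewrite /outdeg -(card_imset _ val_inj); apply: eq_card => y; rewrite !inE.
apply/imsetP/andP => [[z]|[yX exy]]; first by rewrite inE => ez ->; split=> //; exact: valP.
by exists (Sub y yX); rewrite ?inE ?SubK.
Qed.

(** One vertex of each pair [f (i, false)], [f (i, true)] goes to [X], so [X]
    has size [n] automatically and the discrepancy result applies to the
    differences of the two adjacencies. *)
Lemma tournament_halving (R : realType) (n s : nat) (V : finType) (e : rel V) :
  (0 < s)%N -> #|V| = (2 * n)%N -> tournament e -> (forall v, s <= outdeg e v)%N ->
  exists X : {set V}, #|X| = n /\ forall v,
    (outdeg e v)%:R * (1 - 100 ^+ 2 / Num.sqrt s%:R) / 2 <= #|[set y in X | e v y]|%:R :> R.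
Proof.
move=> s0 cardV tour sdeg.
have eqc : #|{: 'I_n * bool}| = #|V| by rewrite card_prod card_ord card_bool mulnC cardV.
pose f (p : 'I_n * bool) : V := enum_val (cast_ord eqc (enum_rank p)).
have f_inj : injective f.
  by move=> p q /enum_val_inj /cast_ord_inj /enum_rank_inj.
have f_bij : bijective f by apply: inj_card_bij f_inj _; rewrite -eqc.
pose a v i b : R := (e v (f (i, b)))%:R.
pose A v i : R := a v i false - a v i true.
have degE v : (outdeg e v)%:R = \sum_i (a v i false + a v i true).
  rewrite /outdeg -sum1_card natr_sum big_mkcond /=.
  rewrite (reindex f) /=; last exact: onW_bij.
  rewrite [LHS](eq_bigr (fun p => a v p.1 p.2)); last first.
    by move=> [i b] _; rewrite inE /a; case: (e v _).
  rewrite -(pair_bigA _ (a v)) /=.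
  by apply: eq_bigr => i _; rewrite big_bool /= addrC.
have A2 v i : A v i ^+ 2 <= a v i false + a v i true /\ A v i ^+ 2 <= 1.
  by rewrite /A /a; case: (e v _); case: (e v _) => /=; split; lra.
have [|v|v i|v||chi bchi] := @weighted_discrepancy R V 'I_n A
    (fun v => (outdeg e v)%:R) s%:R.
- by rewrite ltr0n.
- by rewrite ler_nat.
- by have [] := A2 v i.
- by rewrite degE; apply: ler_sum => i _; have [] := A2 v i.
- by apply: sum_outdeg_pow => // t; apply: card_low_outdeg.
pose g i := f (i, chi i).
have g_inj : injective g by move=> i j /f_inj [].
exists [set g i | i in 'I_n]; split; first by rewrite card_imset ?card_ord.
move=> v; have -> : #|[set y in [set g i | i in 'I_n] | e v y]|%:R = \sum_i a v i (chi i).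
  rewrite -sum1_card natr_sum.
  rewrite (eq_bigl (fun y => (y \in g @: 'I_n) && e v y)) => [|y]; last by rewrite !inE.
  rewrite big_mkcondr big_imset /=; last by move=> i j _ _; apply: g_inj.
  by apply: eq_bigr => i _; rewrite /a /g; case: (e v _).
have -> : \sum_i a v i (chi i)
    = ((outdeg e v)%:R + \sum_i (-1) ^+ chi i * A v i) / 2.
  rewrite degE -big_split /= mulr_suml; apply: eq_bigr => i _.
  by rewrite /A; case: (chi i); rewrite ?expr0 ?expr1; lra.
have := bchi v; rewrite ler_norml => /andP[h _].
rewrite ler_pM2r ?invr_gt0 // mulrBr mulr1 lerD2l.
by apply: le_trans h; rewrite lerN2 mulrA [_ * 100 ^+ 2]mulrC.
Qed.

Lemma dT_ge (R : realType) (s : nat) : 100 ^+ 2 <= Num.sqrt s%:R :> R ->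
  s%:R / 2 - (dT s)%:R <= 100 ^+ 2 * Num.sqrt s%:R :> R.
Proof.
set q := Num.sqrt s%:R => q100.
have q0 : 0 < q by apply: lt_le_trans q100; rewrite exprn_gt0.
have s0 : (0 < s)%N by rewrite -(ltr0n R) -sqrtr_gt0.
have q2 : q ^+ 2 = s%:R by rewrite sqr_sqrtr.
pose y := (s%:R - 100 ^+ 2 * q) / 2.
have y0 : 0 <= y.
  by rewrite /y -q2 expr2 -mulrBl divr_ge0 ?mulr_ge0 ?subr_ge0 // ltW.
pose d := Num.truncn y.
have hd : halving_bound s d.
  move=> n n0 V e cardV tour /leq_min_outdeg[_ sdeg].
  have [X [cardX hX]] := tournament_halving R s0 cardV tour sdeg.
  exists X; split=> //; apply/leq_min_outdeg.
  have dX v : (d <= #|[set y in X | e v y]|)%N.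
    rewrite -(ler_nat R) (le_trans _ (hX v)) // (@le_trans _ _ y) ?truncn_le //.
    rewrite ler_pM2r ?invr_gt0 // -/q.
    apply: (@le_trans _ _ (s%:R * (1 - 100 ^+ 2 / q))).
      by rewrite mulrBr mulr1 lerD2l lerN2 -q2 mulrCA expr2 mulfK ?gt_eqF.
    by rewrite ler_wpM2r ?ler_nat // subr_ge0 ler_pdivrMr ?mul1r.
  split=> [|x]; last by rewrite outdeg_induced.
  have /card_gt0P[v _] : (0 < #|V|)%N by rewrite cardV; lia.
  rewrite card_sig; apply: leq_trans (dX v) _; apply: subset_leq_card.
  by apply/subsetP => z; rewrite inE => /andP[].
have := (dTP s).2 d hd; rewrite -(ler_nat R) => le_d.
have := truncnS_gt y; rewrite -/d -[ltRHS]natr1 => yd.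
have qb : 1 <= 100 ^+ 2 * q.
  have : 100 ^+ 2 * 1 <= 100 ^+ 2 * q by rewrite ler_pM2l ?exprn_gt0 //; lra.
  by lra.
by move: yd; rewrite /y; lra.
Qed.

(** * The set of all tournaments, and reversals of arcs *)

Definition arcs (V : finType) := {ffun V * V -> bool}.

Definition tours (V : finType) : {set arcs V} :=
  [set T : arcs V | [forall x, forall y, T (x, y) == (x != y) && ~~ T (y, x)]].

Definition score (V : finType) (Y : {set V}) (T : arcs V) (x : V) : nat :=
  #|[set y in Y | T (x, y)]|.

Lemma toursP (V : finType) (T : arcs V) :
  reflect (forall x y, T (x, y) = (x != y) && ~~ T (y, x)) (T \in tours V).
Proof.
rewrite inE; apply: (iffP forallP) => h x; last by apply/forallP => y; apply/eqP.
by move=> y; move/forallP: (h x) => /(_ y)/eqP.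
Qed.

Lemma tours_tournament (V : finType) (T : arcs V) : T \in tours V ->
  tournament (fun x y => T (x, y)).
Proof.
move/toursP => h; split=> [x|x y xy]; first by rewrite h eqxx.
by rewrite h xy.
Qed.

Definition reversal (V : finType) (E : rel V) (T : arcs V) : arcs V :=
  [ffun p => T p (+) E p.1 p.2].

Lemma reversalE (V : finType) (E : rel V) (T : arcs V) x y :
  reversal E T (x, y) = T (x, y) (+) E x y.
Proof. by rewrite ffunE. Qed.

Lemma reversalK (V : finType) (E : rel V) : involutive (reversal E).
Proof. by move=> T; apply/ffunP => p; rewrite !ffunE -addbA addbb addbF. Qed.

Lemma reversal_tours (V : finType) (E : rel V) (T : arcs V) :
  symmetric E -> irreflexive E -> T \in tours V -> reversal E T \in tours V.
Proof.
move=> symE irrE /toursP tT; apply/toursP => x y; rewrite !reversalE (symE y).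
have [->|xy] /= := eqVneq x y; first by rewrite irrE tT eqxx.
by rewrite tT xy /= addNb.
Qed.

Definition star (V : finType) (u : V) (A : {set V}) : rel V :=
  fun x y => (x == u) && (y \in A) || (y == u) && (x \in A).

Lemma star_sym (V : finType) (u : V) (A : {set V}) : symmetric (star u A).
Proof. by move=> x y; rewrite /star orbC. Qed.

Lemma star_irr (V : finType) (u : V) (A : {set V}) : u \notin A -> irreflexive (star u A).
Proof.
by move=> uA x; rewrite /star orbb; apply/andP => -[/eqP-> uA']; rewrite uA' in uA.
Qed.

Lemma star_tours (V : finType) (u : V) (A : {set V}) (T : arcs V) : u \notin A ->
  T \in tours V -> reversal (star u A) T \in tours V.
Proof. by move=> uA; apply: reversal_tours; [exact: star_sym | exact: star_irr]. Qed.

Lemma star_center (V : finType) (u y : V) (A : {set V}) (T : arcs V) : u \notin A ->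
  reversal (star u A) T (u, y) = T (u, y) (+) (y \in A).
Proof. by move=> uA; rewrite reversalE /star eqxx (negbTE uA) andbF orbF. Qed.

Lemma star_score_out (V : finType) (u x : V) (A Y : {set V}) (T : arcs V) :
  x != u -> x \notin A -> score Y (reversal (star u A) T) x = score Y T x.
Proof.
move=> xu xA; apply: eq_card => y; rewrite !inE reversalE /star.
by rewrite (negbTE xu) (negbTE xA) andbF addbF.
Qed.

Lemma scoreID (V : finType) (Y Z : {set V}) (T : arcs V) (x : V) :
  score Y T x = (score (Y :&: Z) T x + score (Y :\: Z) T x)%N.
Proof.
rewrite /score -(cardsID Z); congr (_ + _)%N; apply: eq_card => y; rewrite !inE.
  by rewrite andbAC.
by rewrite andbA.
Qed.

(** Reversing the arcs from [u] to a random subset of [S] preserves the uniform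
    distribution on tournaments and keeps [P], but makes [Q] unlikely. *)
Lemma peel_constraint (V : finType) (P Q : pred (arcs V)) (u : V) (S : {set V}) (c : nat) :
  u \notin S ->
  (forall (A : {set V}) T, A \subset S -> P (reversal (star u A) T) = P T) ->
  (forall T, T \in tours V ->
     #|[set A in powerset S | Q (reversal (star u A) T)]| <= c)%N ->
  (#|[set T in tours V | P T && Q T]| * 2 ^ #|S| <= #|[set T in tours V | P T]| * c)%N.
Proof.
move=> uS Pinv Qc; rewrite -card_powerset mulnC -sum_nat_const.
have uA (A : {set V}) : A \in powerset S -> u \notin A.
  by rewrite inE => /subsetP AS; apply: contra uS => /AS.
have e A : A \in powerset S ->
    (#|[set T in tours V | P T && Q T]|
     = \sum_(T in tours V) (P T && Q (reversal (star u A) T)))%N.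
  move=> AS; rewrite -sum1dep_card big_mkcondr /=.
  rewrite -(big_involution _ (fun T => (P T && Q T) : nat)
    (f := reversal (star u A)) (D := tours V)) /=.
  - by apply: eq_bigr => T _; rewrite Pinv // -powersetE.
  - by move=> T; apply: star_tours (uA _ AS).
  - by move=> T _; apply: reversalK.
rewrite (eq_bigr _ e) exchange_big /= -sum1dep_card big_distrl big_mkcondr /=.
apply: leq_sum => T tT; case: (P T) => /=; last by rewrite big1.
rewrite mul1n; apply: leq_trans (Qc T tT).
by rewrite -sum1dep_card big_mkcondr.
Qed.

(** A flip is determined by the out-neighbourhood of [u] that it produces. *)
Lemma card_star_scores (V : finType) (u : V) (S1 S2 : {set V}) (T : arcs V) (c1 c2 : nat) :
  u \notin S1 :|: S2 -> [disjoint S1 & S2] ->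
  (#|[set A in powerset (S1 :|: S2) |
       (score S1 (reversal (star u A) T) u == c1) &&
       (score S2 (reversal (star u A) T) u == c2)]|
   <= 'C(#|S1|, c1) * 'C(#|S2|, c2))%N.
Proof.
move=> uS dis; set D := [set A in _ | _].
have uA (A : {set V}) : A \in D -> u \notin A.
  by rewrite !inE => /andP[/subsetP AS _]; apply: contra uS => /AS.
pose f (A : {set V}) := ([set y in S1 | reversal (star u A) T (u, y)],
                         [set y in S2 | reversal (star u A) T (u, y)]).
have f_inj : {in D &, injective f}.
  move=> A B AD BD [/setP e1 /setP e2]; apply/setP => y.
  have [AS BS] : A \subset S1 :|: S2 /\ B \subset S1 :|: S2.
    by move: AD BD; rewrite !inE => /andP[? _] /andP[? _].
  have [yS|yS] := boolP (y \in S1 :|: S2); last first.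
    have out (C : {set V}) : C \subset S1 :|: S2 -> (y \in C) = false.
      by move=> CS; apply: contraNF yS; apply: (subsetP CS).
    by rewrite !out.
  move: (e1 y) (e2 y); rewrite !inE !star_center ?uA //.
  case/setUP: yS => -> /= h1 h2; first exact: addbI h1.
  exact: addbI h2.
rewrite -(card_in_imset f_inj) -!cards_draws -cardsX; apply: subset_leq_card.
apply/subsetP => _ /imsetP[A AD ->]; move: AD; rewrite !inE => /andP[_ /andP[s1 s2]].
by rewrite s1 s2 !andbT; apply/andP; split; apply/subsetP => y; rewrite inE => /andP[].
Qed.

Lemma bin_le_half (m i : nat) : ('C(m, i) <= 'C(m, m./2))%N.
Proof.
have low j : (j <= m./2)%N -> ('C(m, m./2 - j) <= 'C(m, m./2))%N.
  elim: j => [|j IHj] jm; first by rewrite subn0.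
  apply: leq_trans (IHj (ltnW jm)).
  rewrite -(subnSK jm) -(@leq_pmul2l (m - (m./2 - j.+1))); last by lia.
  by rewrite -mul_bin_left leq_mul2r; apply/orP; right; lia.
have [im|mi] := leqP i m; last by rewrite bin_small.
have [ih|hi] := leqP i m./2.
  by rewrite -{1}(subKn ih) low // leq_subr.
have h : (m - i <= m./2)%N by lia.
by rewrite -bin_sub // -(subKn h) low // leq_subr.
Qed.

(** The square and the factor [k + 1] make the bound hold without any
    constant, so that products over many vertices lose nothing. *)
Lemma central_binomial (k c : nat) : ('C(k, c) ^ 2 * k.+1 <= 4 ^ k)%N.
Proof.
have odd_bin j : ('C(j.*2.+2, j.+1) = 2 * 'C(j.*2.+1, j))%N.
  apply/eqP; rewrite -(@eqn_pmul2l j.+1) // -mul_bin_diag /=.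
  by apply/eqP; lia.
have even j : ('C(j.*2, j) ^ 2 * j.*2.+1 <= 16 ^ j)%N.
  elim: j => // j IHj; rewrite doubleS odd_bin.
  have := mul_bin_down j.*2.+1 j; rewrite /= (_ : j.*2.+1 - j = j.+1)%N; last by lia.
  move: IHj; set B := 'C(_, _); set C := 'C(_, _) => IHj e.
  rewrite -(@leq_pmul2l (j.+1 ^ 2)) ?expn_gt0 //.
  have -> : (j.+1 ^ 2 * ((2 * C) ^ 2 * j.*2.+3)
      = 4 * (j.*2.+1 * j.*2.+3) * (B ^ 2 * j.*2.+1))%N.
    transitivity (4 * ((j.+1 * C) ^ 2 * j.*2.+3))%N.
      by rewrite !expnMn; move: (j.+1 ^ 2)%N (C ^ 2)%N j.*2.+3 => x y z; lia.
    by rewrite -e expnMn expnS expn1; move: (B ^ 2)%N j.*2.+1 j.*2.+3 => x y z; lia.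
  rewrite (expnS 16) [leqRHS]mulnA; apply: leq_mul IHj.
  by rewrite -mul2n expnS expn1; nia.
apply: (@leq_trans ('C(k, k./2) ^ 2 * k.+1)); first by rewrite leq_mul2r leq_exp2r ?bin_le_half.
rewrite -{1 3 4}(odd_double_half k); case: (odd k); rewrite ?add0n ?add1n.
  have := even (k./2).+1; rewrite doubleS odd_bin (expnMn 2) (expnS 16) (expnS 4).
  rewrite -[in (4 ^ _)%N]mul2n expnM -[(4 ^ 2)%N]/16%N.
  set C := 'C(_, _); set P := (16 ^ _)%N; nia.
by rewrite -[in leqRHS]mul2n expnM even.
Qed.

(** * The most popular score sequence *)

Definition realizations (V : finType) (d : V -> nat) : {set arcs V} :=
  [set T in tours V | [forall x, score [set: V] T x == d x]].

(** The arcs from [i] and [j] to such vertices can be exchanged without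
    changing the score of any third vertex. *)
Definition beaten_only_by (V : finType) (i j : V) (T : arcs V) : {set V} :=
  [set y | T (i, y) && ~~ T (j, y)].

Lemma beaten_only_by_score (V : finType) (i j : V) (T : arcs V) :
  (#|beaten_only_by i j T| + score [set: V] T j
    = #|beaten_only_by j i T| + score [set: V] T i)%N.
Proof.
have e a b : score [set: V] T a
    = (#|[set y | T (a, y) && T (b, y)]| + #|beaten_only_by a b T|)%N.
  rewrite /score -(cardsID [set y | T (b, y)]); congr (_ + _)%N.
    by apply: eq_card => y; rewrite !inE.
  by apply: eq_card => y; rewrite !inE andbC.
have c : #|[set y | T (i, y) && T (j, y)]| = #|[set y | T (j, y) && T (i, y)]|.
  by apply: eq_card => y; rewrite !inE andbC.
by rewrite (e i j) (e j i) c; lia.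
Qed.

(** Reversing the arcs at a vertex that [i] beats and [j] does not moves one
    unit of score from [i] to [j].  When the vertex is [j] itself, only the arc
    between [i] and [j] is reversed and the roles of [j] and [i] in the two sets are
    exchanged, whence the transposition. *)
Lemma swap_scores (V : finType) (i j k : V) (T : arcs V) :
  i != j -> T \in tours V -> k \in beaten_only_by i j T ->
  let T' := reversal (star k ([set i; j] :\ k)) T in
  [/\ T' \in tours V,
      forall x, (score [set: V] T' x + (x == i) = score [set: V] T x + (x == j))%N,
      #|beaten_only_by i j T| = #|beaten_only_by i j T'|.+1 &
      tperm i j k \in beaten_only_by j i T'].
Proof.
move=> ij tT; rewrite inE => /andP[Tik Tjk] T'.
have /toursP tour := tT.
have kB : k \notin [set i; j] :\ k by rewrite !inE eqxx.
have ki : k != i by apply: contraTneq Tik => ->; rewrite tour eqxx.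
have tpk : k != j -> tperm i j k = k by move=> kj; rewrite tpermD // eq_sym.
have T'E x y : T' (x, y) = T (x, y) (+) star k ([set i; j] :\ k) x y by rewrite reversalE.
have T'i y : T' (i, y) = T (i, y) && (y != k).
  rewrite T'E /star !inE eqxx (eq_sym i k) (negbTE ki) andbT /=.
  by have [->|_] := eqVneq y k; rewrite ?Tik ?addbF ?andbT.
have T'j y : T' (j, y) = T (j, y) || (y == tperm i j k).
  rewrite T'E /star !inE; have [kj|kj] := eqVneq k j.
    rewrite kj tpermR eqxx /= andbF orbF.
    have [->|yi] := eqVneq y i; last by rewrite andNb addbF orbF.
    by rewrite ij tour -kj Tik andbF.
  rewrite (tpk kj) /= eqxx orbT andbT.
  by have [->|_] := eqVneq y k; rewrite ?(negbTE Tjk) ?addbF ?orbF.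
have Ttk : T (j, tperm i j k) = false.
  have [kj|kj] := eqVneq k j; first by rewrite kj tpermR tour -kj Tik andbF.
  by rewrite (tpk kj) (negbTE Tjk).
split.
- exact: star_tours.
- move=> x; have [->|xi] := eqVneq x i.
    rewrite (negbTE ij) addn0 /score [in RHS](cardsD1 k) !inE Tik addnC.
    congr (_ + _)%N; apply: eq_card => y; by rewrite !inE T'i /= andbC.
  have [->|xj] := eqVneq x j.
    rewrite addn0 /score [in LHS](cardsD1 (tperm i j k)) !inE T'j eqxx orbT addnC.
    congr (_ + _)%N; apply: eq_card => y; rewrite !inE T'j.
    by have [->|_] := eqVneq y (tperm i j k); rewrite ?Ttk ?orbF.
  rewrite !addn0; have [xk|xk] := eqVneq x k; last first.
    by apply: star_score_out; rewrite // !inE negb_and negb_or xi xj orbT.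
  have kj : k != j by rewrite -xk.
  have T'k y : T' (k, y) = T (k, y) (+) ((y == i) || (y == j)).
    rewrite T'E /star eqxx /= [k \in _]inE [k \in [set k]]inE eqxx andbF orbF !inE.
    by have [->|] //= := eqVneq y k; rewrite (negbTE ki) (negbTE kj).
  have Tki : T (k, i) = false by rewrite tour Tik andbF.
  have Tkj : T (k, j) = true by rewrite tour kj Tjk.
  rewrite xk /score (cardsD1 i) [RHS](cardsD1 j) !inE T'k eqxx Tki Tkj /=.
  congr (_ + _)%N; apply: eq_card => y; rewrite !inE T'k.
  have [->|yi] := eqVneq y i; first by rewrite Tki !andbF.
  by have [->|yj] := eqVneq y j; rewrite ?Tkj ?addbF.
- rewrite (cardsD1 k) inE Tik Tjk add1n; congr _.+1; apply: eq_card => y.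
  rewrite !inE T'i T'j negb_or; have [->|yk] /= := eqVneq y k; first by rewrite andbF.
  rewrite andbT; case Tiy : (T (i, y)) => //=; case: (T (j, y)) => //=.
  apply/esym; have [kj|kj] := eqVneq k j.
    by rewrite kj tpermR; apply: contraTneq Tiy => ->; rewrite tour eqxx.
  by rewrite (tpk kj).
- rewrite inE T'j eqxx orbT T'i /=; have [kj|kj] := eqVneq k j.
    by rewrite kj tpermR tour eqxx.
  by rewrite (tpk kj) eqxx andbF.
Qed.

(** Double counting of the single exchanges that turn a realization of [d] into
    one of [d'].  The former has [w] of them; the latter can undo at most as many
    as [w], because [i] still has at least the score of [j]; the weights [1 / w]
    compare the two numbers. *)
Lemma transfer_realizations (V : finType) (i j : V) (d d' : V -> nat) :
  i != j -> (d j + 2 <= d i)%N ->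
  (forall x, d' x + (x == i) = d x + (x == j))%N ->
  (#|realizations d| <= #|realizations d'|)%N.
Proof.
move=> ij dij dd'; rewrite -(ler_nat rat).
pose W (T : arcs V) := beaten_only_by i j T.
pose L (T : arcs V) := beaten_only_by j i T.
pose sw k := reversal (star k ([set i; j] :\ k)).
pose sc (d : V -> nat) (T : arcs V) := [forall x, score [set: V] T x == d x].
pose G k T : rat := if sc d T && (k \in W T) then #|W T|%:R^-1 else 0.
pose H k T : rat := if sc d' T && (tperm i j k \in L T) then #|W T|.+1%:R^-1 else 0.
have WL T : (#|W T| + score [set: V] T j = #|L T| + score [set: V] T i)%N.
  exact: beaten_only_by_score.
have swT k T : T \in tours V -> sw k T \in tours V.
  by apply: star_tours; rewrite !inE eqxx.
(* W loses one vertex under the exchange, hence the successor in H *)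
have GH k T : T \in tours V -> G k (sw k T) <= H k T.
  move=> tT; rewrite /G; case: ifP => [/andP[/forallP scT kW]|_]; last first.
    by rewrite /H; case: ifP => // _; rewrite invr_ge0.
  have [_ sc' Wc tk] := swap_scores ij (swT k T tT) kW.
  rewrite /sw reversalK in sc' Wc tk.
  rewrite /H /L tk andbT /W Wc ifT //; apply/forallP => x; apply/eqP.
  by apply/(@addIn (x == i)); rewrite sc' dd' (eqP (scT x)).
have cardG : #|realizations d|%:R = \sum_(T in tours V) \sum_k G k T.
  rewrite -sum1_card natr_sum (eq_bigl (fun T => (T \in tours V) && sc d T)); last first.
    by move=> T; rewrite inE.
  rewrite big_mkcondr; apply: eq_bigr => T _; rewrite /G.
  case: ifP => [/forallP scT|_]; last by rewrite big1.
  rewrite /= -big_mkcond sumr_const /= -[LHS](@divff _ #|W T|%:R) ?mulr_natl //.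

  rewrite pnatr_eq0; have := WL T; rewrite (eqP (scT i)) (eqP (scT j)); lia.
have cardH : \sum_(T in tours V) \sum_k H k T <= #|realizations d'|%:R.
  rewrite -sum1_card natr_sum (eq_bigl (fun T => (T \in tours V) && sc d' T)); last first.
    by move=> T; rewrite inE.
  rewrite big_mkcondr; apply: ler_sum => T _; rewrite /H.
  case: ifP => [/forallP scT|_]; last by rewrite big1.
  rewrite (reindex_inj (@perm_inj _ (tperm i j))) /=.
  under eq_bigr do rewrite tpermK.
  rewrite -big_mkcond sumr_const -[X in X <= _]mulr_natl ler_pdivrMr ?ltr0n // mul1r ler_nat.
  have := WL T; rewrite (eqP (scT i)) (eqP (scT j)).
  have := dd' i; have := dd' j; rewrite !eqxx (negbTE ij) eq_sym (negbTE ij).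
  by rewrite -/(L T); lia.
rewrite cardG; apply: le_trans cardH; rewrite exchange_big [leRHS]exchange_big /=.
apply: ler_sum => k _; rewrite -(big_involution _ (G k) (f := sw k) (D := tours V)) /=.
- by apply: ler_sum => T tT; apply: GH.
- by move=> T; apply: swT.
- by move=> T _; apply: reversalK.
Qed.

Lemma tours_nonempty (V : finType) : exists T : arcs V, T \in tours V.
Proof.
exists [ffun p : V * V => (enum_rank p.1 < enum_rank p.2)%N]; apply/toursP => x y.
rewrite !ffunE /= -leqNgt ltn_neqAle; congr (~~ _ && _).
by apply/eqP/eqP => [/val_inj/enum_rank_inj //|->].
Qed.

Lemma score_tours_sum (V : finType) (X : {set V}) (T : arcs V) : T \in tours V ->
  (2 * \sum_(x in X) score X T x = #|X| * #|X|.-1)%N.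
Proof. by move=> tT; rewrite -(sum_scores X (tours_tournament tT)). Qed.

(** Among the sequences with the most realizations take one of least sum of
    squares, by maximizing [key]: two scores that differ by 2 or more could be
    brought closer.  Hence all scores differ by at most one, and their sum is
    fixed. *)
Lemma popular_score (V : finType) (n : nat) : (0 < n)%N -> #|V| = (2 * n)%N ->
  exists d : V -> nat,
    (forall d' : V -> nat, #|realizations d'| <= #|realizations d|)%N /\ forall x, (n.-1 <= d x)%N.
Proof.
move=> n0 cardV.
have V0 : (0 < #|V|)%N by rewrite cardV; lia.
pose sq (d : {ffun V -> 'I_#|V|.+1}) := (\sum_x d x ^ 2)%N.
pose K := (\max_(d : {ffun V -> 'I_#|V|.+1}) sq d).+1.
pose key (d : {ffun V -> 'I_#|V|.+1}) := (#|@realizations V (fun x => d x)| * K + (K.-1 - sq d))%N.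
have sqK d : (sq d <= K.-1)%N by exact: (leq_bigmax (F := sq)).
pose d0 : {ffun V -> 'I_#|V|.+1} := [ffun=> ord0].
pose d := [arg max_(d > d0) key d]%N.
have dmax d' : (key d' <= key d)%N by rewrite /d; case: arg_maxnP => // d1 _; apply.
have below (T : arcs V) x : (score [set: V] T x < #|V|.+1)%N by rewrite ltnS max_card.
have popular (d' : V -> nat) : (#|realizations d'| <= #|@realizations V (fun x => d x)|)%N.
  have [->|/set0Pn[T]] := eqVneq (realizations d') set0; first by rewrite cards0.
  rewrite inE => /andP[_ /forallP scT].
  pose e : {ffun V -> 'I_#|V|.+1} := [ffun x => inord (d' x)].
  have de x : e x = d' x :> nat by rewrite ffunE inordK // -(eqP (scT x)).
  have -> : realizations d' = @realizations V (fun x => e x).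
    by apply/setP => T'; rewrite !inE; congr (_ && _); apply: eq_forallb => x; rewrite de.
  have := dmax e; rewrite /key; have := sqK e; have := sqK d; rewrite /K /=.
  set k := (\max_ _ _)%N; nia.
have flat i j : (d i < d j + 2)%N.
  rewrite ltnNge; apply/negP => dij.
  have ij : i != j by apply: contraTneq dij => ->; lia.
  pose e : {ffun V -> 'I_#|V|.+1} :=
    [ffun x => inord (if x == i then (d i).-1 else if x == j then (d j).+1 else d x)].
  have dj := ltn_ord (d j); have di := ltn_ord (d i).
  have eE x : e x = (if x == i then (d i).-1 else if x == j then (d j).+1 else d x) :> nat.
    by rewrite ffunE inordK //; do 2?case: ifP => // _; lia.
  have le_r : (#|@realizations V (fun x => d x)| <= #|@realizations V (fun x => e x)|)%N.
    apply: (transfer_realizations ij dij) => x; rewrite eE.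
    have [->|xi] := eqVneq x i; first by rewrite (negbTE ij); lia.
    by have [->|xj] := eqVneq x j; lia.
  have lt_sq : (sq e < sq d)%N.
    rewrite /sq (bigD1 i) // (bigD1 j) 1?eq_sym //= [ltnRHS](bigD1 i) //=.
    rewrite [in ltnRHS](bigD1 j) 1?eq_sym //= !eE eqxx eq_sym (negbTE ij) eqxx.
    rewrite (eq_bigr (fun x => (d x) ^ 2)%N) => [|x /andP[xi xj]]; last first.
      by rewrite eE (negbTE xi) (negbTE xj).
    move: dij; move: (nat_of_ord (d i)) (nat_of_ord (d j)) => p q.
    case: p => [|p] qp; first by lia.
    by rewrite !addnA ltn_add2r /= !expnS !expn0; nia.
  have := dmax e; rewrite leqNgt => /negP; apply; rewrite /key.
  rewrite -addnS; apply: leq_add; first by rewrite leq_mul2r le_r orbT.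
  by rewrite ltn_sub2l // (leq_trans lt_sq).
exists (fun x => nat_of_ord (d x)); split=> // x.
have [T tT] := tours_nonempty V.
have : (0 < #|@realizations V (fun x => d x)|)%N.
  apply: leq_trans (popular (score [set: V] T)); apply/card_gt0P; exists T.
  by rewrite inE tT; apply/forallP.
case/card_gt0P => T1; rewrite inE => /andP[tT1 /forallP scT1].
have sum1 := score_tours_sum [set: V] tT1; rewrite cardsT cardV in sum1.
rewrite leqNgt; apply/negP => dx.
have : (\sum_(y in [set: V]) score [set: V] T1 y <= 2 * n * n.-1)%N.
  rewrite -[in leqRHS]cardV -[in leqRHS]cardsT -sum_nat_const; apply: leq_sum => y _.
  by rewrite (eqP (scT1 y)); have := flat y x; lia.
move: sum1; set w := (\sum_(y in _) _)%N; clear - n0; nia.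
Qed.

(** * Popular score sequences have many realizations *)

Lemma tours_sign_family (R : realType) (V : finType) (u : V) :
  sign_family (tours V) (fun w T => (-1) ^+ T (u, w) : R) (enum (~: [set u])).
Proof.
have uw w : w \in enum (~: [set u]) -> u \notin [set w].
  by rewrite mem_enum !inE eq_sym.
move=> w wu; split=> [T _|]; first by rewrite sqrr_sign.
exists (reversal (star u [set w])); split=> [T|T _|T _|i _ iw T _].
- exact: star_tours (uw w wu).
- exact: reversalK.
- by rewrite star_center ?uw // inE eqxx addbT signrN.
- by rewrite star_center ?uw // inE (negbTE iw) addbF.
Qed.

Lemma sign_sum_score (R : realType) (V : finType) (u : V) (T : arcs V) : T \in tours V ->
  \sum_(w <- enum (~: [set u])) 1 * (-1) ^+ T (u, w)
    = #|V|%:R - 1 - 2 * (score [set: V] T u)%:R :> R.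
Proof.
move=> /toursP tT; have Tuu : T (u, u) = false by rewrite tT eqxx.
have -> : #|V|%:R = \sum_(w : V) 1 :> R by rewrite sumr_const.
have -> : (score [set: V] T u)%:R = \sum_w (T (u, w))%:R :> R.
  rewrite /score -sum1_card natr_sum big_mkcond; apply: eq_bigr => w _.
  by rewrite !inE; case: (T _).
rewrite (bigD1 u) //= [X in _ - 2 * X](bigD1 u) //= Tuu add0r [1 + _]addrC addrK mulr_sumr -sumrB.
rewrite big_enum /=; apply: eq_big => [w|w _]; first by rewrite !inE.
by case: (T _) => /=; rewrite ?expr0 ?expr1; lra.
Qed.

Lemma code_factor_linear (R : realType) (h : R) : 0 < h ->
  (1 - expR (- h^-1))^-1 <= 1 + h.
Proof.
move=> h0; have L0 : 0 < h^-1 by rewrite invr_gt0.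
have e1 : h^-1 <= expR h^-1 - 1 by have := expR_ge1Dx h^-1; lra.
have e0 : 0 < expR h^-1 - 1 by apply: lt_le_trans e1.
have -> : (1 - expR (- h^-1))^-1 = 1 + (expR h^-1 - 1)^-1.
  by rewrite expRN; field; rewrite !gt_eqF ?expR_gt0.
by rewrite lerD2l -[leRHS]invrK lef_pV2 ?posrE.
Qed.

(** The usual enumeration of the integers by naturals, applied to [a - n], so
    that a single code entry records the signed deviation of a score. *)
Definition zigzag (n a : nat) : nat := if (n <= a)%N then (a - n).*2 else (n - a).*2.-1.

Lemma zigzag_inj (n : nat) : injective (zigzag n).
Proof. by move=> a b; rewrite /zigzag; do 2!case: leqP => ?; lia. Qed.

Lemma zigzag_le (R : realType) (n a : nat) :
  (zigzag n a)%:R <= `|(2 * n)%:R - 1 - 2 * a%:R| :> R.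
Proof.
rewrite natrM /zigzag; case: leqP => h.
  rewrite ler_normr; apply/orP; right; rewrite -muln2 natrM natrB //; lra.
rewrite ler_normr; apply/orP; left.
have : ((n - a).*2.-1.+1)%:R = (n - a)%:R * 2 :> R by rewrite prednK ?double_gt0 ?subn_gt0 // -muln2 natrM.
by rewrite -natr1 natrB 1?ltnW //; lra.
Qed.

(** On average a score deviates from its mean by the order of [sqrt n], so
    codes charged [1 / sqrt (2 n)] per unit cost a bounded amount per vertex. *)
Lemma tours_le_popular (R : realType) (V : finType) (n M : nat) :
  (0 < n)%N -> #|V| = (2 * n)%N ->
  (forall d : V -> nat, #|realizations d| <= M)%N ->
  #|tours V|%:R <= (expR 1 * (1 + Num.sqrt (2 * n)%:R)) ^+ (2 * n) * M%:R :> R.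
Proof.
move=> n0 cardV popular.
pose N : R := (2 * n)%:R; pose q := Num.sqrt N.
have N0 : 0 < N by rewrite ltr0n; lia.
have q0 : 0 < q by rewrite sqrtr_gt0.
have q2 : q ^+ 2 = N by rewrite sqr_sqrtr // ltW.
pose c (T : arcs V) u := zigzag n (score [set: V] T u).
have avg : \sum_(T in tours V) \sum_(u : V) q^-1 * (c T u)%:R <= N * #|tours V|%:R.
  pose Y u (T : arcs V) : R := \sum_(w <- enum (~: [set u])) 1 * (-1) ^+ T (u, w).
  apply: (@le_trans _ _ (\sum_(T in tours V) \sum_(u : V) (Y u T ^+ 2 / N + 1) / 2)).
    apply: ler_sum => T tT; apply: ler_sum => u _.
    have zY : (c T u)%:R <= `|Y u T|.
      by rewrite /Y sign_sum_score // cardV zigzag_le.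
    rewrite -(real_normK (num_real (Y u T))) -q2 -expr_div_n.
    apply: (@le_trans _ _ (`|Y u T| / q)); first by rewrite mulrC ler_pM2r ?invr_gt0.
    by have := sqr_ge0 (`|Y u T| / q - 1); set z := _ / q; rewrite sqrrB; lra.
  have -> : N = \sum_(u : V) 1 by rewrite /N -cardV sumr_const.
  rewrite exchange_big mulr_suml /=; apply: ler_sum => u _.
  rewrite -mulr_suml big_split /= -mulr_suml sumr_const.
  have [-> _] := sign_family_moments (fun=> 1) (@tours_sign_family R V u) (enum_uniq _).
  rewrite big_enum /= sumr_const expr1n cardsC1 cardV.
  have : (2 * n).-1%:R <= N by rewrite ler_nat leq_pred.
  move=> le1; have t0 : 0 <= #|tours V|%:R :> R by [].
  have : #|tours V|%:R * (2 * n).-1%:R / N <= #|tours V|%:R.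
    by rewrite ler_pdivrMr // ler_wpM2l.
  by rewrite sumr_const -/N; lra.
have fib T : T \in tours V ->
    #|[set T' in tours V | [forall u, c T' u == c T u]]|%:R <= M%:R :> R.
  move=> _; rewrite ler_nat; apply: leq_trans (popular (score [set: V] T)).
  apply: subset_leq_card; apply/subsetP => T'; rewrite !inE => /andP[-> /forallP eqc].
  by apply/forallP => u; apply/eqP/(@zigzag_inj n)/eqP; apply: eqc.
have := pigeonhole_codes (L := fun=> q^-1) _ (ler0n _ M) avg fib.
move=> h; apply: le_trans (h _) _ => [_|]; first by rewrite invr_gt0.
rewrite ler_wpM2r // exprMn -expRM_natl mulr1 -/N ler_wpM2l ?expR_ge0 //.
rewrite prodr_const cardV -/q lerXn2r ?nnegrE ?code_factor_linear //.
  by rewrite invr_ge0 subr_ge0 ltW // expRN_lt1 // invr_gt0.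
by rewrite addr_ge0 // ltW.
Qed.

(** * Few tournaments have prescribed scores overall and in a half *)

Lemma binomial_density (R : realType) (k c : nat) :
  'C(k, c)%:R <= 2 ^+ k * (Num.sqrt k.+1%:R)^-1 :> R.
Proof.
have s0 : 0 < Num.sqrt k.+1%:R :> R by rewrite sqrtr_gt0.
rewrite ler_pdivlMr // -(@ler_pXn2r _ 2) ?nnegrE ?mulr_ge0 ?exprn_ge0 ?(ltW s0) //.
rewrite exprMn sqr_sqrtr // -exprM mulnC exprM -!natrX -natrM ler_nat.
exact: central_binomial.
Qed.

(** Two scores are prescribed at every vertex of [U], so that the score in a
    half and the score outside it can be treated in one step. *)
Definition constrained (V : finType) (Y Z : V -> {set V}) (a b : V -> nat) (U : {set V}) :
    {set arcs V} :=
  [set T in tours V | [forall x in U, (score (Y x) T x == a x) && (score (Z x) T x == b x)]].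

(** Reverse arcs between [u] and vertices outside [u |: U] only: the scores
    prescribed at the other vertices of [U] do not notice. *)
Lemma constrained_peel (R : realType) (V : finType) (Y Z : V -> {set V})
    (a b : V -> nat) (U : {set V}) (u : V) :
  u \notin U -> [disjoint Y u & Z u] ->
  #|constrained Y Z a b (u |: U)|%:R
   <= #|constrained Y Z a b U|%:R * (Num.sqrt #|Y u :\: (u |: U)|.+1%:R)^-1
       * (Num.sqrt #|Z u :\: (u |: U)|.+1%:R)^-1 :> R.
Proof.
move=> uU dYZ; set S1 := Y u :\: _; set S2 := Z u :\: _.
pose P T := [forall x in U, (score (Y x) T x == a x) && (score (Z x) T x == b x)].
pose Q T := (score (Y u) T u == a u) && (score (Z u) T u == b u).
have uS : u \notin S1 :|: S2 by rewrite !inE eqxx.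
have dS : [disjoint S1 & S2].
  by apply: disjointWl (subsetDl _ _) _; apply: disjointWr (subsetDl _ _) dYZ.
have cS : #|S1 :|: S2| = (#|S1| + #|S2|)%N.
  by rewrite cardsU disjoint_setI0 // cards0 subn0.
(* the arcs from u into u |: U are left alone by the flips *)
have split_score (W : {set V}) (A : {set V}) T : A \subset S1 :|: S2 ->
    score W (reversal (star u A) T) u
    = (score (W :\: (u |: U)) (reversal (star u A) T) u + score (W :&: (u |: U)) T u)%N.
  move=> AS; rewrite (scoreID _ (u |: U)) addnC; congr (_ + _)%N.
  apply: eq_card => y; rewrite !inE; case: (boolP (_ || _)) => [yU|_]; last by rewrite andbF.
  have uA : u \notin A by apply: contra uS; apply: (subsetP AS).
  have yA : (y \in A) = false.
    by apply: contraTF yU => /(subsetP AS)/setUP[]/setDP[_]; rewrite !inE.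
  by rewrite star_center // yA addbF.
pose h1 := 'C(#|S1|, #|S1|./2); pose h2 := 'C(#|S2|, #|S2|./2).
have Pinv (A : {set V}) T : A \subset S1 :|: S2 -> P (reversal (star u A) T) = P T.
  move=> AS; apply: eq_forallb => x; case: (boolP (x \in U)) => //= xU.
  have xu : x != u by apply: contraNneq uU => <-.
  have xA : x \notin A.
    apply: contraL xU => /(subsetP AS)/setUP[]/setDP[_].
      by rewrite !inE negb_or => /andP[].
    by rewrite !inE negb_or => /andP[].
  by rewrite !star_score_out.
have Qcount : forall T, T \in tours V ->
    (#|[set A in powerset (S1 :|: S2) | Q (reversal (star u A) T)]| <= h1 * h2)%N.
  move=> T _; pose c1 := (a u - score (Y u :&: (u |: U)) T u)%N.
  pose c2 := (b u - score (Z u :&: (u |: U)) T u)%N.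
  apply: leq_trans (leq_mul (bin_le_half #|S1| c1) (bin_le_half #|S2| c2)).
  apply: leq_trans (card_star_scores T c1 c2 uS dS).
  apply: subset_leq_card; apply/subsetP => A; rewrite !inE => /andP[AS /andP[/eqP q1 /eqP q2]].
  rewrite AS /c1 /c2 -q1 -q2 (split_score (Y u) A T AS) (split_score (Z u) A T AS).
  by rewrite !addnK !eqxx.
have := peel_constraint uS Pinv Qcount.
have -> : [set T in tours V | P T && Q T] = constrained Y Z a b (u |: U).
  apply/setP => T; rewrite !inE; congr (_ && _); apply/andP/forallP.
    case=> /forallP pT qT x; rewrite !inE; apply/implyP => /orP[/eqP->//|xU].
    exact: implyP (pT x) xU.
  move=> pT; split; last by have := pT u; rewrite !inE eqxx.
  by apply/forallP => x; apply/implyP => xU; have := pT x; rewrite !inE xU orbT.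
rewrite -/(constrained Y Z a b U) -(ler_nat R) !natrM natrX cS exprD => h.
rewrite -(@ler_pM2r _ (2 ^+ #|S1| * 2 ^+ #|S2|)) ?mulr_gt0 ?exprn_gt0 //.
apply: le_trans h _; rewrite -!mulrA ler_wpM2l //.
apply: le_trans (ler_pM _ _ (binomial_density R _ _) (binomial_density R _ _)) _ => //.
by rewrite le_eqVlt; apply/orP; left; apply/eqP; ring.
Qed.

(** Release the vertices outside [X] first.  The [k]-th of them then faces [k]
    free vertices, while a vertex of [X] released later faces all [n] vertices
    outside [X] as well as the [k] already released in [X]. *)
Lemma scores_in_half_count (R : realType) (V : finType) (X : {set V}) (n : nat)
    (d g : V -> nat) :
  #|X| = n -> #|V| = (2 * n)%N ->
  #|[set T in realizations d | [forall x in X, score X T x == g x]]|%:R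
   <= #|tours V|%:R / (n`!%:R * Num.sqrt n.+1%:R ^+ n) :> R.
Proof.
move=> cX cV.
pose r (k : nat) : R := (Num.sqrt k.+1%:R)^-1.
have r0 k : 0 <= r k by rewrite invr_ge0 sqrtr_ge0.
(* in X: inner and outer score; elsewhere: total score and a void condition *)
pose Y x := if x \in X then X else [set: V].
pose Z x := if x \in X then ~: X else set0.
pose a x := if x \in X then g x else d x.
pose b x := if x \in X then (d x - g x)%N else 0%N.
have cXC : #|~: X| = n by rewrite cardsCs setCK cX cV; lia.
have dYZ x : [disjoint Y x & Z x].
  by rewrite -setI_eq0 /Y /Z; case: ifP => _; rewrite ?setICr ?setI0.
have full : (#|[set T in realizations d | [forall x in X, score X T x == g x]]|
    <= #|constrained Y Z a b [set: V]|)%N.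
  apply: subset_leq_card; apply/subsetP => T.
  rewrite !inE => /andP[/andP[-> /forallP sd] /forallP sg] /=.
  apply/forallP => x; rewrite inE /= /Y /Z /a /b; have := implyP (sg x).
  case: ifP => [xX /(_ isT)/eqP gx | _ _].
    rewrite gx eqxx -(eqP (sd x)) (scoreID [set: V] X) setTI setTD gx addKn; exact: eqxx.
  rewrite (eqP (sd x)) eqxx /= /score; apply/eqP/eqP; rewrite cards_eq0.
  by apply/eqP/setP => y; rewrite !inE.
(* releasing the vertices outside X *)
have outer m (U : {set V}) : X \subset U -> #|~: U| = m ->
    #|constrained Y Z a b [set: V]|%:R
      <= #|constrained Y Z a b U|%:R * \prod_(k < m) r k.
  elim: m U => [|m IHm] U XU cU.
    by move: (cards0_eq cU) => /(congr1 (@setC V)); rewrite setCK setC0 => ->; rewrite big_ord0 mulr1.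
  have /card_gt0P[u] : (0 < #|~: U|)%N by rewrite cU.
  rewrite inE => uU; have uX : u \notin X by apply: contra uU; apply: (subsetP XU).
  have cU' : #|~: (u |: U)| = m.
    move: cU; rewrite [#|~: U|](cardsD1 u) inE uU => -[<-].
    by congr #|pred_of_set _|; rewrite setCU setIC setDE.
  apply: le_trans (IHm (u |: U) _ cU') _; first by rewrite subsetU // XU orbT.
  rewrite big_ord_recr /= mulrA mulrAC ler_wpM2r ?prodr_ge0 //.
  apply: le_trans (constrained_peel R a b uU (dYZ u)) _.
  by rewrite /Y /Z (negbTE uX) setTD cU' set0D cards0 sqrtr1 invr1 mulr1.
(* releasing the vertices of X *)
have inner m (U : {set V}) : U \subset X -> #|X :\: U| = m ->
    #|constrained Y Z a b X|%:R
      <= #|constrained Y Z a b U|%:R * \prod_(k < m) (r k * r n).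
  elim: m U => [|m IHm] U UX cU.
    have -> : U = X.
      by apply/eqP; rewrite eqEsubset UX -setD_eq0 -cards_eq0 cU.
    by rewrite big_ord0 mulr1.
  have /card_gt0P[u] : (0 < #|X :\: U|)%N by rewrite cU.
  rewrite inE => /andP[uU uX].
  have cU' : #|X :\: (u |: U)| = m.
    by move: cU; rewrite (cardsD1 u) inE uU uX => -[<-]; rewrite setDDl setUC.
  apply: le_trans (IHm (u |: U) _ cU') _; first by rewrite subUset sub1set uX.
  rewrite big_ord_recr /= mulrA mulrAC ler_wpM2r ?prodr_ge0 // => [k _|]; first by rewrite mulr_ge0.
  apply: le_trans (constrained_peel R a b uU (dYZ u)) _.
  rewrite /Y /Z uX cU' (_ : ~: X :\: (u |: U) = ~: X) ?cXC ?mulrA //.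
  apply/setP => y; rewrite !inE; case: (boolP (y \in X)) => yX; first by rewrite andbF.
  rewrite andbT negb_or; apply/andP; split; first by apply: contraNneq yX => ->.
  by apply: contra yX; apply: (subsetP UX).
have none : (#|constrained Y Z a b set0| <= #|tours V|)%N.
  by apply: subset_leq_card; apply/subsetP => T; rewrite inE => /andP[].
have prod_r m : \prod_(k < m) (r k * r k) = m`!%:R^-1.
  elim: m => [|m IHm]; first by rewrite big_ord0 invr1.
  by rewrite big_ord_recr /= IHm /r -invfM -expr2 sqr_sqrtr // factS natrM invfM mulrC.
have := outer n X (subxx _) cXC; have := inner n set0 (sub0set _); rewrite setD0 => /(_ cX) h1 h2.
apply: (@le_trans _ _ #|constrained Y Z a b [set: V]|%:R); first by rewrite ler_nat.
apply: le_trans h2 _.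
apply: (@le_trans _ _ (#|tours V|%:R * \prod_(k < n) (r k * r n) * \prod_(k < n) r k)).
  rewrite ler_wpM2r ?prodr_ge0 //; apply: le_trans h1 _.
  by rewrite ler_wpM2r ?ler_nat ?prodr_ge0 // => k _; rewrite mulr_ge0.
rewrite -mulrA -big_split /= (eq_bigr (fun k : 'I_n => (r k * r k) * r n)); last first.
  by move=> k _; ring.
by rewrite big_split /= prod_r prodr_const card_ord invfM -exprVn.
Qed.

(** * Counting even halves *)

(** The excesses of the inner scores over [d0] are naturals with a fixed sum,
    at most [h] on average, and a code charged [1 / h] per unit has bounded cost. *)
Lemma even_halves_count (R : realType) (V : finType) (X : {set V}) (n d0 : nat)
    (d : V -> nat) (h : R) :
  #|X| = n -> #|V| = (2 * n)%N -> 0 < h -> n.-1%:R / 2 - d0%:R <= h ->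
  #|[set T in realizations d | [forall x in X, d0 <= score X T x]%N]|%:R
   <= (expR 1 * (1 + h)) ^+ n * (#|tours V|%:R / (n`!%:R * Num.sqrt n.+1%:R ^+ n)).
Proof.
move=> cX cV h0 hd; set A := [set T in _ | _].
pose c (T : arcs V) (k : {x | x \in X}) := (score X T (val k) - d0)%N.
set F := #|tours V|%:R / _.
have F0 : 0 <= F by rewrite divr_ge0 ?mulr_ge0 ?exprn_ge0 ?sqrtr_ge0.
have avg : \sum_(T in A) \sum_k h^-1 * (c T k)%:R <= n%:R * #|A|%:R.
  rewrite mulrC mulr_natl -sumr_const; apply: ler_sum => T.
  rewrite inE => /andP[]; rewrite inE => /andP[tT _] /forallP dT0.
  rewrite -mulr_sumr mulrC ler_pdivrMr //.
  have -> : \sum_k (c T k)%:R = \sum_(x in X) ((score X T x)%:R - d0%:R) :> R.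
    rewrite (big_sub (mem X) (fun x => (score X T x)%:R - d0%:R)); apply: eq_bigr => k _.
    by rewrite /c natrB //; apply: (implyP (dT0 (val k))); exact: valP.
  rewrite sumrB sumr_const cX -natr_sum -[d0%:R *+ n]mulr_natl.
  have := score_tours_sum X tT; rewrite cX => /(congr1 (fun m => m%:R : R)).
  rewrite !natrM => e.
  have := ler_wpM2l (ler0n R n) hd; lra.
have fib T : T \in A ->
    #|[set T' in A | [forall k, c T' k == c T k]]|%:R <= F.
  move=> TA; apply: le_trans (scores_in_half_count R d (score X T) cX cV).
  rewrite ler_nat; apply: subset_leq_card; apply/subsetP => T'.
  move: TA; rewrite !inE => /andP[_ /forallP g0] /andP[/andP[-> /forallP g1] /forallP ec].
  apply/forallP => x; apply/implyP => xX.
  have := ec (Sub x xX); rewrite /c /=.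
  have := implyP (g0 x) xX; have := implyP (g1 x) xX; lia.
have := pigeonhole_codes (L := fun=> h^-1) _ F0 avg fib.
move=> le; apply: le_trans (le _) _ => [_|]; first by rewrite invr_gt0.
rewrite ler_wpM2r // exprMn -expRM_natl mulr1 ler_wpM2l ?expR_ge0 //.
rewrite prodr_const card_sig cX lerXn2r ?nnegrE ?code_factor_linear //.
  by rewrite invr_ge0 subr_ge0 ltW // expRN_lt1 // invr_gt0.
by rewrite addr_ge0 // ltW.
Qed.

Lemma expR1_le (R : realType) : expR 1 <= 27 / 8 :> R.
Proof.
have h := expR_ge1Dx (- (3^-1) : R); have h0 := expR_gt0 (3^-1 : R).
have e : expR (3^-1 : R) * expR (- (3^-1)) = 1 by rewrite expRN divff ?gt_eqF.
have e3 : expR (3^-1) <= 3 / 2 :> R by nra.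
have -> : expR 1 = expR (3^-1) ^+ 3 :> R by rewrite -expRM_natl; congr expR; field.
have -> : 27 / 8 = (3 / 2) ^+ 3 :> R by field.
by rewrite lerXn2r ?nnegrE ?expR_ge0 //; lra.
Qed.

Lemma expn_le_fact (R : realType) (n : nat) : n%:R ^+ n <= expR 1 ^+ n * n`!%:R :> R.
Proof.
elim: n => [|n IHn]; first by rewrite !expr0 mul1r.
rewrite factS natrM exprS mulrCA ler_wpM2l //.
case: n IHn => [|n] IHn; first by rewrite expr0 expr1 mulr1; have := expR_ge1Dx (1 : R); lra.
have n0 : (0 : R) < n.+1%:R by [].
have -> : n.+2%:R ^+ n.+1 = (1 + n.+1%:R^-1) ^+ n.+1 * n.+1%:R ^+ n.+1 :> R.
  by rewrite -exprMn mulrDl mul1r mulVf ?gt_eqF // natr1.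
rewrite [expR 1 ^+ _]exprS -mulrA ler_pM ?exprn_ge0 ?addr_ge0 ?invr_ge0 //.
have -> : expR 1 = expR n.+1%:R^-1 ^+ n.+1 :> R by rewrite -expRM_natl mulfV ?gt_eqF.
rewrite lerXn2r ?nnegrE ?expR_ge0 ?addr_ge0 ?invr_ge0 //; exact: expR_ge1Dx.
Qed.

Lemma card_sets_le (V : finType) (n : nat) (P : pred {set V}) :
  #|V| = (2 * n)%N -> (#|P| <= 4 ^ n)%N.
Proof.
move=> cV; rewrite (_ : 4 = 2 ^ 2)%N // -expnM -cV -cardsT -card_powerset powersetT cardsT.
exact: max_card.
Qed.

(** Every realization of the popular sequence, for [n = s + 1], has a half
    counted by [even_halves_count]; comparing the union bound [upM] with the lower
    bound [upt] leaves an inequality between [n]-th powers. *)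
Lemma halving_bound_upper (R : realType) (s d : nat) : halving_bound s d ->
  Num.sqrt s%:R <= 40 * 100 * (s%:R / 2 - d%:R + 2) :> R.
Proof.
move=> hb; pose n := s.+1; pose V := 'I_(2 * n).
have cV : #|V| = (2 * n)%N by rewrite card_ord.
have [d1 [popular d1s]] := @popular_score V n isT cV.
have half T : T \in realizations d1 ->
    exists X : {set V}, #|X| = n /\ forall x, x \in X -> (d <= score X T x)%N.
  rewrite inE => /andP[tT /forallP sT].
  have [|X [cX]] := hb n isT V _ cV (tours_tournament tT).
    apply/leq_min_outdeg; split=> [|x]; first by rewrite cV; lia.
    apply: leq_trans (d1s x) _; rewrite -(eqP (sT x)).
    by apply: subset_leq_card; apply/subsetP => y; rewrite !inE.
  move=> /leq_min_outdeg[_ dX]; exists X; split=> // x xX.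
  by have := dX (Sub x xX); rewrite outdeg_induced.
have [T0 tT0] := tours_nonempty V.
have real0 : (0 < #|realizations d1|)%N.
  apply: leq_trans (popular (score [set: V] T0)); apply/card_gt0P; exists T0.
  by rewrite inE tT0; apply/forallP.
(* the summand 1 keeps h positive *)
pose h : R := s%:R / 2 - d%:R + 1.
have h1 : 1 <= h.
  have /card_gt0P[T TT] := real0; have [X [cX dX]] := half T TT.
  move: TT; rewrite inE => /andP[tT _].
  have sX := score_tours_sum X tT; rewrite cX in sX.
  have : (\sum_(x in X) d <= \sum_(x in X) score X T x)%N by apply: leq_sum.
  rewrite sum_nat_const cX => le.
  have : (2 * d <= s)%N by rewrite -(@leq_pmul2l n) //; move: sX le; rewrite /n /=; nia.
  by rewrite -(ler_nat R) natrM /h; lra.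
pose E : R := expR 1; pose q : R := Num.sqrt n.+1%:R.
pose t : R := #|tours V|%:R; pose M : R := #|realizations d1|%:R.
have E0 : 0 < E by exact: expR_gt0.
have q0 : 0 < q by rewrite sqrtr_gt0.
have t0 : 0 < t by rewrite ltr0n; apply/card_gt0P; exists T0.
have M0 : 0 < M by rewrite ltr0n.
have f0 : 0 < n`!%:R :> R by rewrite ltr0n fact_gt0.
have h0 : 0 <= 1 + h by lra.
have upM : M <= 4 ^+ n * ((E * (1 + h)) ^+ n * (t / (n`!%:R * q ^+ n))).
  have cover : M <= \sum_(X : {set V} | #|X| == n)
      #|[set T in realizations d1 | [forall x in X, d <= score X T x]%N]|%:R.
    rewrite -natr_sum ler_nat -sum1_card.
    under [leqRHS]eq_bigr do rewrite -sum1dep_card big_mkcondr.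
    rewrite exchange_big /=; apply: leq_sum => T /half[X [/eqP cX dX]].
    rewrite (bigD1 X) //= ifT //; apply/forallP => x; apply/implyP; exact: dX.
  apply: le_trans cover _.
  apply: (@le_trans _ _ (\sum_(X : {set V} | #|X| == n)
     ((E * (1 + h)) ^+ n * (t / (n`!%:R * q ^+ n))))).
    apply: ler_sum => X /eqP cX; apply: even_halves_count => //; first by lra.
    by rewrite /h /=; lra.
  rewrite sumr_const -[X in X <= _]mulr_natl ler_wpM2r //.
    apply: mulr_ge0; first by rewrite exprn_ge0 // mulr_ge0 // ltW.
    by rewrite divr_ge0 ?(ltW t0) // mulr_ge0 ?(ltW f0) // exprn_ge0 // ltW.
  by rewrite -natrX ler_nat; apply: card_sets_le.
have upt := @tours_le_popular R V n _ isT cV popular; rewrite -/t -/M -/E in upt.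
set w := Num.sqrt _ in upt.
have w0 : 0 <= w by rewrite sqrtr_ge0.
have w2 : (1 + w) ^+ 2 <= 6 * n%:R.
  have e : w ^+ 2 = 2 * n%:R by rewrite sqr_sqrtr // natrM.
  have n1 : 1 <= n%:R :> R by rewrite ler1n.
  have := sqr_ge0 (w - 1); rewrite sqrrB sqrrD e; lra.
have upt2 : t <= (E ^+ 2 * (6 * n%:R)) ^+ n * M.
  apply: le_trans upt _; rewrite ler_pM2r // exprM.
  apply: lerXn2r; rewrite ?nnegrE.
  - by rewrite exprn_ge0 // mulr_ge0 ?(ltW E0) // addr_ge0.
  - by rewrite mulr_ge0 ?exprn_ge0 ?(ltW E0) // mulr_ge0.
  - by rewrite exprMn ler_pM2l ?exprn_gt0.
(* combine upM, upt2 and n ^ n <= e ^ n * n!, and cancel t *)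
have nq : (n%:R * q) ^+ n <= (24 * E ^+ 4 * n%:R * (1 + h)) ^+ n.
  have e1 : t * (n`!%:R * q ^+ n) <= (24 * E ^+ 3 * n%:R * (1 + h)) ^+ n * t.
    rewrite -ler_pdivlMr ?mulr_gt0 ?exprn_gt0 //.
    apply: le_trans upt2 _; rewrite -mulrA.
    apply: le_trans (ler_wpM2l _ upM) _.
      by rewrite exprn_ge0 ?mulr_ge0 ?exprn_ge0 ?ltW.
    rewrite !mulrA -!exprMn le_eqVlt; apply/orP; left; apply/eqP.
    congr (_ ^+ _ * _ / _); ring.
  have e2 : n`!%:R * q ^+ n <= (24 * E ^+ 3 * n%:R * (1 + h)) ^+ n.
    by move: e1; rewrite mulrC ler_pM2r.
  rewrite exprMn; apply: (@le_trans _ _ (E ^+ n * n`!%:R * q ^+ n)).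
    by rewrite ler_pM2r ?exprn_gt0 // expn_le_fact.
  rewrite -mulrA; apply: le_trans (ler_wpM2l _ e2) _; first by rewrite exprn_ge0 // ltW.
  rewrite -exprMn le_eqVlt; apply/orP; left; apply/eqP; congr (_ ^+ _); ring.
have n0 : 0 < n%:R :> R by rewrite ltr0n.
move: nq; rewrite ler_pXn2r ?nnegrE ?mulr_ge0 ?exprn_ge0 ?(ltW E0) ?(ltW q0) ?(ltW n0) //.
rewrite -mulrA [_ * (n%:R * _)]mulrCA ler_pM2l // => qE.
have E4 : E ^+ 4 <= 150.
  apply: (@le_trans _ _ ((27 / 8) ^+ 4)); last by rewrite !exprS expr0; lra.
  by rewrite lerXn2r ?nnegrE ?(ltW E0) ?expR1_le //; lra.
have sq : Num.sqrt s%:R <= q by apply: ler_wsqrtr; rewrite ler_nat /n !leqW.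
apply: le_trans sq _; apply: le_trans qE _.
have -> : s%:R / 2 - d%:R + 2 = 1 + h by rewrite /h; ring.
by rewrite ler_wpM2r //; lra.
Qed.

Lemma dT_le (R : realType) (s : nat) : 160 * 100 <= Num.sqrt s%:R :> R ->
  (80 * 100)^-1 * Num.sqrt s%:R <= s%:R / 2 - (dT s)%:R :> R.
Proof. by move=> hs; have := @halving_bound_upper R s _ (dTP s).1; lra. Qed.

Theorem theorem1p3 (R : realType) :
  exists (c C : R) (s0 : nat),
    [/\ 0 < c, 0 < C &
      forall s : nat, (s0 <= s)%N ->
        c * Num.sqrt s%:R <= s%:R / 2 - (dT s)%:R /\
        s%:R / 2 - (dT s)%:R <= C * Num.sqrt s%:R].
Proof.
exists (80 * 100)^-1, (100 ^+ 2), (Num.truncn ((160 * 100) ^+ 2 : R)).+1.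
split; [by rewrite invr_gt0 mulr_gt0 | by rewrite exprn_gt0 | move=> s hs].
have {hs} hs : 160 * 100 <= Num.sqrt s%:R :> R.
  have -> : 160 * 100 = Num.sqrt ((160 * 100) ^+ 2) :> R.
    by rewrite sqrtr_sqr ger0_norm // mulr_ge0.
  apply: ler_wsqrtr; apply: le_trans (ltW (truncnS_gt _)) _.
  by rewrite ler_nat.
by split; [exact: dT_le | apply: dT_ge; lra].
Qed.
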